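(* Let $\mathcal{A}$ be a minimal linear strand (MLS) central arrangement of $n$ hyperplanes in $\mathbb{C}^3$, with Orlik-Solomon algebra $A$. Then the graded Betti numbers of a minimal free resolution of $A$ over the exterior algebra $E$ are given, for $i\ge1$, by $$b'_{i,i+1}= i\sum_{X\in L_2(\mathcal{A})}\binom{\mu(X)+i-1}{i+1},$$ $$b'_{i,i+2}= b'_{i+1,i+2}+\binom{i+1}{2}\binom{n+i-2}{i+2}-\binom{n+i-2}{i}\sum_{X\in L_2(\mathcal{A})}\binom{\mu(X)}{2}.$$
   Context: $\Bbbk$ is a field of characteristic $0$. For a finite central arrangement $\mathcal{A}=\{H_1,\dots,H_n\}$ of hyperplanes in $\mathbb{C}^\ell$, let $E$ be the exterior algebra over $\Bbbk$ on degree-one generators $e_1,\dots,e_n$, with derivation $\partial$ given by $\partial(e_i)=1$ and the graded Leibniz rule, and $e_J=e_{i_1}\wedge\cdots\wedge e_{i_r}$ for $J=\{i_1<\dots<i_r\}$. The Orlik-Solomon ideal $I\subset E$ is generated by all $\partial e_J$ with $\operatorname{codim}\bigcap_{i\in J}H_i<|J|$; the Orlik-Solomon algebra is $A=E/I$, graded by degree. The graded Betti numbers are $b'_{ij}=\dim_\Bbbk\operatorname{Tor}_i^E(A,\Bbbk)_j$ ($j$ is the internal degree). $L_2(\mathcal{A})$ is the set of rank (codimension) $2$ elements of the intersection lattice of $\mathcal{A}$ and $\mu$ is the Möbius function of that lattice; for $X\in L_2(\mathcal{A})$, $\mu(X)=|\{H\in\mathcal{A}: H\supset X\}|-1$. $\mathcal{A}$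 is called minimal linear strand (MLS) if $b'_{23}=2\sum_{X\in L_2(\mathcal{A})}\binom{\mu(X)+1}{3}$. *)

(* Defs.v *)
From HB Require Import structures.
From mathcomp Require Import all_boot all_order all_algebra all_field.
From mathcomp Require Import ring zify.

Set Implicit Arguments.
Unset Strict Implicit.
Unset Printing Implicit Defensive.

Import GRing.Theory.
Local Open Scope ring_scope.

(* The exterior algebra on e_0, ..., e_(n-1): [x S] is the coefficient in x of
   e_S, the product of the e_i for i in S in increasing order. *)
Definition exterior (K : fieldType) (n : nat) := {ffun {set 'I_n} -> K^o}.

HB.instance Definition _ (K : fieldType) n :=
  Vector.copy (exterior K n) {ffun {set 'I_n} -> K^o}.

(* e_S e_T = (-1)^(ninv S T) e_(S :|: T) when S and T are disjoint. *)
Definition ninv n (S T : {set 'I_n}) : nat :=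
  (\sum_(i in S) \sum_(j in T) (j < i))%N.

Section ExteriorAlgebra.
Variables (K : fieldType) (n : nat).
Implicit Types (x y z : exterior K n) (S T U : {set 'I_n}).

Definition ext_basis S : exterior K n := [ffun T => (T == S)%:R : K^o].

Definition ext_gen (i : 'I_n) : exterior K n := ext_basis [set i].

Definition ext_mul x y : exterior K n :=
  [ffun U : {set 'I_n} => \sum_(S : {set 'I_n} | S \subset U)
     ((-1) ^+ ninv S (U :\: S) * x S * y (U :\: S) : K^o)].

Lemma ninvUl S T U : [disjoint S & T] ->
  ninv (S :|: T) U = (ninv S U + ninv T U)%N.
Proof.
move=> dST; rewrite /ninv -bigU //; apply: eq_bigl => i.
by rewrite !inE.
Qed.

Lemma ninvUr S T U : [disjoint T & U] ->
  ninv S (T :|: U) = (ninv S T + ninv S U)%N.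
Proof.
move=> dTU; rewrite /ninv -big_split; apply: eq_bigr => i _ /=.
by rewrite -bigU //; apply: eq_bigl => j; rewrite !inE.
Qed.

Lemma ninv0s T : ninv set0 T = 0%N.
Proof. by rewrite /ninv big_set0. Qed.

Lemma ninvs0 S : ninv S set0 = 0%N.
Proof. by rewrite /ninv big1 // => i _; rewrite big_set0. Qed.

Let setUDK S U : S \subset U -> S :|: (U :\: S) = U.
Proof. by move=> SU; rewrite -{1}(setIidPr SU) setID. Qed.

Let setUKD S T : [disjoint S & T] -> (S :|: T) :\: S = T.
Proof.
by move=> dST; rewrite setDUl setDv set0U; apply/setDidPl; rewrite disjoint_sym.
Qed.

Fact ext_mulA : associative ext_mul.
Proof.
move=> x y z; apply/ffunP => U; rewrite !ffunE.
under eq_bigr => S SU do rewrite ffunE mulr_sumr.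
under [RHS]eq_bigr => V VU do rewrite ffunE mulr_sumr mulr_suml.
rewrite [RHS](exchange_big_dep (fun S => S \subset U)) /=; last first.
  by move=> V S VU SV; apply: subset_trans VU.
apply: eq_bigr => S SU.
rewrite [RHS](reindex_onto (fun T => S :|: T) (fun V => V :\: S)) /=; last first.
  by move=> V /andP[_ SV]; exact: setUDK.
apply: eq_big => [T|T].
  rewrite subsetUl andbT subUset SU /= subsetD; congr (_ && _).
  apply/idP/eqP => [dTS|<-]; first by rewrite setUKD // disjoint_sym.
  by rewrite disjoint_sym -setI_eq0 setDE setICA setICr setI0.
rewrite subsetD => /andP[TU dTS].
have dST : [disjoint S & T] by rewrite disjoint_sym.
rewrite setUKD // -setDDl.
have TUS : T \subset U :\: S by rewrite subsetD TU.
have dT X : [disjoint T & X :\: T].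
  by rewrite -setI_eq0 setDE setICA setICr setI0.
rewrite -{1 2}(setUDK TUS) ninvUr // setUKD // ninvUl // !exprD.
ring.
Qed.

Fact ext_mul1l : left_id (ext_basis set0) ext_mul.
Proof.
move=> x; apply/ffunP => U; rewrite ffunE (bigD1 set0) ?sub0set //= big1.
  by rewrite ninv0s setD0 ffunE eqxx !mul1r addr0.
by move=> S /andP[_ /negbTE S0]; rewrite ffunE S0 mulr0 mul0r.
Qed.

Fact ext_mul1r : right_id (ext_basis set0) ext_mul.
Proof.
move=> x; apply/ffunP => U; rewrite ffunE (bigD1 U) //= big1.
  by rewrite setDv ninvs0 ffunE eqxx mul1r mulr1 addr0.
move=> S /andP[SU /negbTE S0]; rewrite [X in _ * X]ffunE setD_eq0.
case US: (U \subset S); last by rewrite mulr0.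
by rewrite eqEsubset SU US in S0.
Qed.

Fact ext_mulDl : left_distributive ext_mul +%R.
Proof.
move=> x y z; apply/ffunP => U; rewrite !ffunE -big_split; apply: eq_bigr => S _.
by rewrite ffunE /= mulrDr mulrDl.
Qed.

Fact ext_mulDr : right_distributive ext_mul +%R.
Proof.
move=> x y z; apply/ffunP => U; rewrite !ffunE -big_split; apply: eq_bigr => S _.
by rewrite ffunE /= mulrDr.
Qed.

Fact ext_one_neq0 : ext_basis set0 != 0.
Proof.
by apply/eqP => /ffunP /(_ set0) /eqP; rewrite !ffunE eqxx oner_eq0.
Qed.

Fact ext_scaleAl (a : K) x y : a *: ext_mul x y = ext_mul (a *: x) y.
Proof.
apply/ffunP => U; rewrite !ffunE scaler_sumr; apply: eq_bigr => S _.
by rewrite ffunE /= /GRing.scale /= mulrA [a * _]mulrCA.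
Qed.

Fact ext_scaleAr (a : K) x y : a *: ext_mul x y = ext_mul x (a *: y).
Proof.
apply/ffunP => U; rewrite !ffunE scaler_sumr; apply: eq_bigr => S _.
by rewrite ffunE /= /GRing.scale /= mulrCA.
Qed.

HB.instance Definition _ := GRing.Zmodule_isNzRing.Build (exterior K n)
  ext_mulA ext_mul1l ext_mul1r ext_mulDl ext_mulDr ext_one_neq0.

HB.instance Definition _ := GRing.Lmodule_isLalgebra.Build K (exterior K n)
  ext_scaleAl.

HB.instance Definition _ := GRing.Lalgebra_isAlgebra.Build K (exterior K n)
  ext_scaleAr.

HB.instance Definition _ := Algebra_isFalgebra.Build K (exterior K n).

Definition ext_diff x : exterior K n :=
  \sum_S x S *: \sum_(i in S)
    (-1) ^+ #|[set j in S | (j < i)%N]| *: ext_basis (S :\ i).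

Definition ext_homog (d : nat) x : Prop := forall S, x S != 0 -> #|S| = d.

Definition ext_aug x : K := x set0.

Let ninv1l (i : 'I_n) T : ninv [set i] T = #|[set j in T | (j < i)%N]|.
Proof.
rewrite /ninv big_set1 -sum1dep_card big_mkcondr /=.
by apply: eq_bigr => j _; case: (j < i)%N.
Qed.

Let ninv1r S (i : 'I_n) : i \notin S ->
  (ninv S [set i] + ninv [set i] S)%N = #|S|.
Proof.
move=> iS; rewrite /ninv big_set1 -sum1_card -big_split; apply: eq_bigr => j jS.
rewrite big_set1 /=; case: ltngtP => // /val_inj ij.
by rewrite ij jS in iS.
Qed.

Lemma ext_mul_basis S T : [disjoint S & T] ->
  ext_basis S * ext_basis T = (-1) ^+ ninv S T *: ext_basis (S :|: T).
Proof.
move=> dST; apply/ffunP => U; rewrite [in LHS]ffunE [in RHS]ffunE [in RHS]ffunE.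
have [->|UST] := eqVneq U (S :|: T).
  rewrite (bigD1 S) ?subsetUl //= setUKD // big1 => [|V /andP[_ /negbTE VS]].
    by rewrite !ffunE !eqxx addr0 !mulr1 /GRing.scale /= mulr1.
  by rewrite ffunE VS mulr0 mul0r.
rewrite scaler0 big1 // => V VU.
have [VS|VS] := eqVneq V S; last by rewrite ffunE (negbTE VS) mulr0 mul0r.
rewrite [X in _ * X]ffunE; case: eqVneq => [UVT|]; last by rewrite mulr0.
by case/eqP: UST; rewrite -VS -UVT setUDK.
Qed.

Let ext_basis_seq (s : seq 'I_n) : sorted ltn (map val s) ->
  ext_basis [set:: s] = \prod_(i <- s) ext_gen i.
Proof.
elim: s => [_|i s IHs] /=.
  by rewrite big_nil; congr ext_basis; apply/setP => j; rewrite !inE.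
move=> p; rewrite big_cons -IHs ?(path_sorted p) // /ext_gen.
have /allP lt_is := order_path_min ltn_trans p.
have gt_i j : j \in s -> (i < j)%N by move=> js; apply: lt_is; apply: map_f.
rewrite ext_mul_basis; last first.
  rewrite disjoints1 inE; apply/negP => /gt_i.
  by rewrite ltnn.
rewrite ninv1l (_ : [set j in _ | _] = set0) ?cards0 ?expr0 ?scale1r.
  by congr ext_basis; apply/setP => j; rewrite !inE.
apply/setP => j; rewrite !inE; apply/negP => /andP[/gt_i ij ji].
by have := ltn_trans ij ji; rewrite ltnn.
Qed.

Lemma ext_basisE S : ext_basis S = \prod_(i in S) ext_gen i.
Proof.
rewrite -big_filter [index_enum _]unlock -ext_basis_seq.
  by congr ext_basis; apply/setP => i; rewrite !inE mem_enum.
rewrite /(enum _) -enumT; apply: (subseq_sorted ltn_trans) (iota_ltn_sorted 0 n).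
by rewrite -val_enum_ord map_subseq ?filter_subseq.
Qed.

Lemma ext_sum_basis x : x = \sum_S x S *: ext_basis S.
Proof.
apply/ffunP => U; rewrite sum_ffunE (bigD1 U) //= big1.
  by rewrite !ffunE eqxx addr0 /GRing.scale /= mulr1.
by move=> S /negbTE SU; rewrite !ffunE eq_sym SU scaler0.
Qed.

Fact ext_diff_is_linear : linear ext_diff.
Proof.
move=> a x y; rewrite /ext_diff scaler_sumr -big_split; apply: eq_bigr => S _.
by rewrite !ffunE scalerDl scalerA.
Qed.

HB.instance Definition _ := GRing.isLinear.Build K (exterior K n) (exterior K n)
  *:%R ext_diff ext_diff_is_linear.

Let ext_diffE x U :
  ext_diff x U = \sum_(i | i \notin U) (-1) ^+ ninv [set i] U * x (i |: U).
Proof.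
rewrite sum_ffunE.
under eq_bigr => S _ do rewrite ffunE sum_ffunE scaler_sumr.
rewrite (exchange_big_dep xpredT) //= [RHS]big_mkcond; apply: eq_bigr => i _.
case: ifP => [iU|/negbFE iU]; last first.
  rewrite big1 // => S iS; rewrite !ffunE; case: eqVneq => [US|].
    by move: iU; rewrite US !inE eqxx.
  by rewrite !scaler0.
rewrite (bigD1 (i |: U)) ?setU11 //= big1 => [|S /andP[iS SU]].
  rewrite !ffunE setU1K // eqxx addr0 /GRing.scale /= mulr1 mulrC ninv1l.
  congr (_ ^+ _ * _); apply: eq_card => j; rewrite !inE.
  by case: (eqVneq j i) => [->|]; rewrite ?ltnn ?andbF.
rewrite !ffunE; case: eqVneq => [US|]; last by rewrite !scaler0.
by rewrite US setD1K ?eqxx in SU.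
Qed.

Let ext_genM i y U : (ext_gen i * y) U =
  if i \in U then (-1) ^+ ninv [set i] (U :\ i) * y (U :\ i) else 0.
Proof.
rewrite ffunE; case: ifP => iU.
  rewrite (bigD1 [set i]) ?sub1set //= big1 => [|S /andP[_ /negbTE Si]].
    by rewrite ffunE eqxx addr0 mulr1.
  by rewrite ffunE Si mulr0 mul0r.
rewrite big1 // => S SU; rewrite ffunE; case: eqVneq => [Si|]; last first.
  by rewrite mulr0 mul0r.
by rewrite Si sub1set iU in SU.
Qed.

Let ext_diff1 : ext_diff 1 = 0.
Proof.
apply/ffunP => U; rewrite ext_diffE big1 ?ffunE // => i iU.
rewrite ffunE; case: eqVneq => [/setP/(_ i)|]; last by rewrite mulr0.
by rewrite !inE eqxx.
Qed.

Let ext_diff_genM i y : ext_diff (ext_gen i * y) = y - ext_gen i * ext_diff y.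
Proof.
apply/ffunP => U; rewrite ext_diffE [in RHS]ffunE [(- _ : exterior K n) U]ffunE ext_genM.
case: ifP => iU; last first.
  rewrite oppr0 addr0 (bigD1 i) ?iU //= big1 => [|k /andP[_ ki]].
    by rewrite ext_genM setU11 setU1K ?iU // addr0 mulrA -expr2 sqrr_sign mul1r.
  by rewrite ext_genM !inE eq_sym (negbTE ki) iU mulr0.
rewrite ext_diffE [in RHS](bigD1 i) ?inE ?eqxx //= setD1K // mulrDr mulrA.
rewrite -expr2 sqrr_sign mul1r opprD addrA addrN add0r mulr_sumr -sumrN.
apply: eq_big => [k|k kU].
  by rewrite !inE negb_and negbK; case: eqVneq => [->|]; rewrite ?iU ?andbT.
have ki : k != i by apply: contraNneq kU => ->.
have kUi : k \notin U :\ i by rewrite !inE (negbTE kU) andbF.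
rewrite ext_genM !inE iU orbT.
have -> : (k |: U) :\ i = k |: U :\ i.
  by rewrite setDUl; congr (_ :|: _); apply/setDidPl; rewrite disjoints1 inE.
have d1 : [disjoint [set k] & U :\ i] by rewrite disjoints1.
have d2 : [disjoint [set i] & U :\ i] by rewrite disjoints1 !inE eqxx.
rewrite -{1}(setD1K iU) !ninvUr // !exprD.
have : (ninv [set k] [set i] + ninv [set i] [set k])%N = 1%N.
  by rewrite ninv1r ?cards1 // inE eq_sym.
by case: (ninv [set k] _) => [|[|?]]; case: (ninv [set i] [set k]) => [|[|?]] // _;
  rewrite expr0 expr1; ring.
Qed.

Lemma ext_diff_gen i : ext_diff (ext_gen i) = 1.
Proof. by rewrite -[ext_gen i]mulr1 ext_diff_genM ext_diff1 mulr0 subr0. Qed.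

Lemma ext_diffM p x y : ext_homog p x ->
  ext_diff (x * y) = ext_diff x * y + (-1) ^+ p * (x * ext_diff y).
Proof.
have prodM (s : seq 'I_n) : let z : exterior K n := \prod_(i <- s) ext_gen i in
  ext_diff (z * y) = ext_diff z * y + (-1) ^+ size s * (z * ext_diff y).
  elim: s => [|i s IHs] /=.
    by rewrite !big_nil ext_diff1 mul0r add0r !mul1r.
  rewrite !big_cons -mulrA !ext_diff_genM IHs mulrDr opprD mulrBl addrA mulrA.
  by congr (_ + _); rewrite exprS mulN1r mulNr !mulrA commr_sign.
move=> hx; rewrite [x]ext_sum_basis mulr_suml !linear_sum mulr_suml.
rewrite mulr_suml mulr_sumr -big_split; apply: eq_bigr => S _ /=.
have [->|/hx Sp] := eqVneq (x S) 0; first by rewrite !scale0r !mul0r linear0 mulr0 mul0r addr0.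
rewrite -scalerAl !linearZ /= -!scalerAl -scalerAr -scalerDr; congr (_ *: _).
rewrite ext_basisE -big_filter prodM; congr (_ + _ ^+ _ * _).
by rewrite [index_enum _]unlock -cardE.
Qed.

Fact ext_aug_is_zmod_morphism : zmod_morphism ext_aug.
Proof. by move=> x y; rewrite /ext_aug !ffunE. Qed.

Fact ext_aug_is_monoid_morphism : monoid_morphism ext_aug.
Proof.
split=> [|x y]; rewrite /ext_aug ffunE ?eqxx //.
rewrite (bigD1 set0) //= big1 => [|S /andP[]].
  by rewrite ninv0s setD0 addr0 mul1r.
by rewrite subset0 => ->.
Qed.

HB.instance Definition _ := GRing.isZmodMorphism.Build (exterior K n) K
  ext_aug ext_aug_is_zmod_morphism.

HB.instance Definition _ := GRing.isMonoidMorphism.Build (exterior K n) K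
  ext_aug ext_aug_is_monoid_morphism.

End ExteriorAlgebra.

(* A graded free resolution ... -> F_1 -> F_0 -> E/I -> 0 by finitely generated
   left E-modules, for I a homogeneous two-sided ideal.  Elements of
   F_i = E^(res_rank i) are row vectors, on which the differentials act by right
   multiplication; the a-th basis vector of F_i has internal degree [res_deg a].
   F_0 -> E/I is given by representatives in E of the images of the basis. *)
Record free_resolution (K : fieldType) (n : nat)
    (I : {vspace exterior K n}) := FreeResolution {
  res_rank : nat -> nat;
  res_deg : forall i, 'I_(res_rank i) -> nat;
  res_aug : 'cV[exterior K n]_(res_rank 0);
  res_diff : forall i, 'M[exterior K n]_(res_rank i.+1, res_rank i);
  res_aug_homog : forall a, ext_homog (res_deg a) (res_aug a 0);
  res_diff_homog : forall i a b (S : {set 'I_n}),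
    res_diff i a b S != 0 -> (#|S| + res_deg b)%N = res_deg a;
  res_aug_surj : forall x, exists v : 'rV_(res_rank 0), x - (v *m res_aug) 0 0 \in I;
  res_exact0 : forall v : 'rV_(res_rank 0),
    (v *m res_aug) 0 0 \in I <-> exists w, v = w *m res_diff 0;
  res_exact : forall i (v : 'rV_(res_rank i.+1)),
    v *m res_diff i = 0 <-> exists w, v = w *m res_diff i.+1 }.

(* [tor_dim F i j] is the dimension of the degree j part of
   Tor_i^E(E/I, K) = H_i(K (x)_E F); tensoring with K applies the augmentation
   E -> K to the entries of the differentials. *)
Section Tor.
Variables (K : fieldType) (n : nat) (I : {vspace exterior K n}).
Variable F : free_resolution I.

Definition tor_diff i : 'M[K]_(res_rank F i.+1, res_rank F i) :=
  map_mx (@ext_aug K n) (res_diff F i).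

Definition tor_degree_part i j : 'M[K]_(res_rank F i) :=
  diag_mx (\row_a (res_deg a == j)%:R).

Definition tor_cycles i j : 'M[K]_(res_rank F i) :=
  match i with
  | 0 => tor_degree_part 0 j
  | i'.+1 => (tor_degree_part i'.+1 j :&: kermx (tor_diff i'))%MS
  end.

Definition tor_boundaries i j : 'M[K]_(res_rank F i.+1, res_rank F i) :=
  tor_degree_part i.+1 j *m tor_diff i.

Definition tor_dim i j : nat :=
  (\rank (tor_cycles i j) - \rank (tor_boundaries i j))%N.

Lemma tor_boundaries_sub i j : (tor_boundaries i j <= tor_cycles i j)%MS.
Proof.
have bndE : tor_boundaries i j = tor_diff i *m tor_degree_part i j.
  rewrite /tor_boundaries mul_diag_mx mul_mx_diag; apply/matrixP => a b.
  rewrite !mxE mulrC; have [->|] := eqVneq (ext_aug (res_diff F i a b)) 0.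
    by rewrite !mul0r.
  by move=> /res_diff_homog <-; rewrite cards0 add0n.
case: i bndE => [|i] bndE /=; first by rewrite bndE submxMl.
rewrite sub_capmx bndE submxMl -bndE; apply/sub_kermxP.
rewrite -mulmxA -map_mxM /= (_ : res_diff F i.+1 *m res_diff F i = 0).
  by rewrite map_mx0 mulmx0.
apply/row_matrixP => a; rewrite row_mul row0; apply/res_exact.
by exists (delta_mx 0 a); rewrite -rowE.
Qed.

End Tor.

Record arrangement (F : fieldType) (l n : nat) := Arrangement {
  hyperplane :> 'I_n -> {vspace 'rV[F]_l};
  hyperplane_codim1 : forall i, (\dim (hyperplane i)).+1 = l;
  hyperplane_inj : injective hyperplane }.

Section Arrangement.
Variables (F : fieldType) (l n : nat) (A : arrangement F l n).

Definition codim (X : {vspace 'rV[F]_l}) : nat := (l - \dim X)%N.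

Definition flat (J : {set 'I_n}) : {vspace 'rV[F]_l} :=
  (\bigcap_(i in J) A i)%VS.

Definition dependent (J : {set 'I_n}) : bool := (codim (flat J) < #|J|)%N.

Definition lattice : seq {vspace 'rV[F]_l} :=
  undup [seq flat J | J : {set 'I_n}].

Definition L2 : seq {vspace 'rV[F]_l} := [seq X <- lattice | codim X == 2].

Definition mu (X : {vspace 'rV[F]_l}) : nat := #|[set i | (X <= A i)%VS]|.-1.


(* The lattice is ordered by reverse inclusion, with least element [fullv]. *)
Fixpoint moebius_rec (k : nat) (X : {vspace 'rV[F]_l}) : int :=
  if X == fullv then 1 else
  if k is k'.+1 then
    - \sum_(Y <- lattice | (X <= Y)%VS && (Y != X)) moebius_rec k' Y
  else 0.

Arguments moebius_rec : simpl never.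

Definition moebius X := moebius_rec (codim X) X.

Let flat0 : flat set0 = fullv.
Proof. by rewrite /flat big_set0. Qed.

Let dim_full : \dim (fullv : {vspace 'rV[F]_l}) = l.
Proof. by rewrite dimvf /dim /= mul1n. Qed.

Let full_lattice : fullv \in lattice.
Proof. by rewrite mem_undup -flat0 map_f ?mem_enum. Qed.

Let hyper_lattice i : A i \in lattice.
Proof.
by rewrite mem_undup; apply/mapP; exists [set i]; rewrite ?mem_enum // /flat big_set1.
Qed.

Let hyper_full i : A i != fullv.
Proof.
apply/eqP => /(congr1 (fun X => \dim X)).
by rewrite dim_full; have := hyperplane_codim1 A i; lia.
Qed.

Let moebius_recS k X : moebius_rec k.+1 X = if X == fullv then 1 else
  - \sum_(Y <- lattice | (X <= Y)%VS && (Y != X)) moebius_rec k Y.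
Proof. by []. Qed.

Let moebius_rec_full k : moebius_rec k fullv = 1.
Proof. by case: k => [|k]; rewrite /moebius_rec eqxx. Qed.

Let moebius_rec1 Y : Y != fullv -> moebius_rec 1 Y = -1.
Proof.
move=> Yf; rewrite moebius_recS (negPf Yf) big_mkcond.
rewrite (bigD1_seq fullv) ?undup_uniq //= moebius_rec_full.
rewrite subvf eq_sym Yf big1_seq // => Z /andP[/negPf ZN _].
by rewrite /moebius_rec ZN if_same.
Qed.

Lemma moebius_L2 X : X \in L2 -> moebius X = mu X.
Proof.
rewrite mem_filter => /andP[/eqP X2 XL]; rewrite /moebius X2.
have dX : \dim X = (l - 2)%N by move: X2; rewrite /codim; lia.
have l2 : (1 < l)%N by move: X2; rewrite /codim; lia.
have Xf : X != fullv by apply: contra_eq_neq dX => ->; rewrite dim_full; lia.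
rewrite moebius_recS (negPf Xf) big_mkcond (bigD1_seq fullv) ?undup_uniq //=.
rewrite -big_mkcondr subvf eq_sym Xf moebius_rec_full -big_filter; set s := [seq Y <- _ | _].
have : perm_eq s [seq A i | i in [set i | (X <= A i)%VS]].
  apply: uniq_perm => [| |Y].
  - by rewrite filter_uniq ?undup_uniq.
  - by rewrite map_inj_uniq ?enum_uniq //; apply: hyperplane_inj.
  rewrite mem_filter; apply/idP/imageP; last first.
    case=> i; rewrite inE => XA ->; rewrite XA hyper_full hyper_lattice !andbT.
    apply/eqP => /(congr1 (fun Z => \dim Z)).
    by rewrite dX; have := hyperplane_codim1 A i; lia.
  case/andP=> /and3P[Yf XY YX]; rewrite mem_undup => /mapP[J _ YJ].
  have [J0|[i iJ]] := set_0Vmem J; first by rewrite YJ J0 flat0 eqxx in Yf.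
  have YA : (Y <= A i)%VS by rewrite YJ; apply: bigcapv_inf iJ _.
  exists i; first by rewrite inE (subv_trans XY).
  apply/eqP; rewrite eqEdim YA /=.
  have : (\dim X < \dim Y)%N.
    by rewrite ltn_neqAle dimvS // andbT (dimv_leqif_eq XY) eq_sym.
  by rewrite dX; have := hyperplane_codim1 A i; lia.
move=> /(perm_big _) ->; rewrite big_map (eq_bigr (fun _ => -1)); last first.
  by move=> i _; have := moebius_rec1 (hyper_full i).
rewrite big_enum sumr_const /=.
have : (0 < #|[set i | (X <= A i)%VS]|)%N.
  move: XL; rewrite mem_undup => /mapP[J _ XJ].
  have [J0|[i iJ]] := set_0Vmem J; first by rewrite XJ J0 flat0 eqxx in Xf.
  by apply/card_gt0P; exists i; rewrite inE XJ; apply: bigcapv_inf iJ _.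
rewrite /mu; case: #|_| => // m _ /=.
by rewrite mulrSr mulNrn; lia.
Qed.

Definition OS_ideal (K : fieldType) : {vspace exterior K n} :=
  ({:exterior K n} * <<[seq ext_diff (ext_basis K J) | J in dependent]>>
     * {:exterior K n})%VS.

Definition MLS (K : fieldType) (P : free_resolution (OS_ideal K)) : Prop :=
  tor_dim P 2 3 = (2 * \sum_(X <- L2) 'C((mu X).+1, 3))%N.

End Arrangement.

Arguments MLS {F l n} A {K} P.

Section FreeResolutionExists.
Variables (K : fieldType) (n : nat).
Local Notation E := (exterior K n).
Local Notation V r := {ffun 'I_r -> E}.

Definition ext_comp (d : nat) (x : E) : E :=
  [ffun S : {set 'I_n} => if #|S| == d then x S else 0].

Let shift_comp r (deg : 'I_r -> nat) d (v : V r) : V r :=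
  [ffun a => [ffun S : {set 'I_n} =>
     if (#|S| + deg a)%N == d then v a S else 0] : E].

Record graded_sub := GradedSub {
  gs_rank : nat;
  gs_deg : 'I_gs_rank -> nat;
  gs_sub : {vspace V gs_rank};
  gs_left : forall x v, v \in gs_sub -> [ffun a => x * v a] \in gs_sub;
  gs_comp : forall d v, v \in gs_sub -> shift_comp gs_deg d v \in gs_sub }.

Section Cover.
Variable G : graded_sub.

Let I := ('I_(\dim (gs_sub G)) * 'I_(\max_a @gs_deg G a + n).+1)%type.

Let D := (\max_a @gs_deg G a + n).+1.

Let rk := #|{: I}|.

Let deg (p : 'I_rk) : nat := (enum_val p).2.

Let gen (p : 'I_rk) : V (gs_rank G) :=
  shift_comp (@gs_deg G) (deg p) (vbasis (gs_sub G))`_(enum_val p).1.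

Definition cover_mx : 'M[E]_(rk, gs_rank G) := \matrix_(p, a) gen p a.

Lemma cover_homog p a (S : {set 'I_n}) :
  cover_mx p a S != 0 -> (#|S| + gs_deg a)%N = deg p.
Proof. by rewrite mxE !ffunE; case: (_ =P deg p) => //; rewrite eqxx. Qed.

Let gen_in p : gen p \in gs_sub G.
Proof. by apply: gs_comp; apply/vbasis_mem/mem_nth; rewrite size_tuple. Qed.

Let sum_comp (v : V (gs_rank G)) :
  v = \sum_(d < D) shift_comp (@gs_deg G) d v.
Proof.
apply/ffunP => a; apply/ffunP => S; rewrite sum_ffunE sum_ffunE.
have ltD : (#|S| + gs_deg a < D)%N.
  rewrite ltnS [leqLHS]addnC leq_add ?(leq_bigmax a) //.
  by rewrite -[leqRHS]card_ord max_card.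
rewrite (bigD1 (Ordinal ltD)) //= !ffunE eqxx big1 ?addr0 // => d /eqP dD.
rewrite !ffunE; case: eqP => // e; case: dD; exact: val_inj.
Qed.

Lemma cover_mxP (v : 'rV[E]_(gs_rank G)) :
  ([ffun a => v 0 a] \in gs_sub G) <-> exists w, v = w *m cover_mx.
Proof.
split=> [vN|[w ->]].
  pose c k := coord (vbasis (gs_sub G)) k [ffun a => v 0 a].
  exists (\row_p (c (enum_val p).1 *: 1)); apply/rowP => a.
  have -> : v 0 a = [ffun a => v 0 a] a by rewrite ffunE.
  rewrite [in LHS](coord_vbasis vN) sum_ffunE mxE.
  rewrite [RHS](reindex (@enum_rank I)) /=; last first.
    by exists enum_val => p _; rewrite ?enum_rankK ?enum_valK.
  under [RHS]eq_bigr => q _ do rewrite !mxE enum_rankK -scalerAl mul1r.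
  transitivity (\sum_(k < \dim (gs_sub G)) \sum_(d < D) c k *:
      (shift_comp (@gs_deg G) d (vbasis (gs_sub G))`_k a)); last first.
    by rewrite pair_bigA; apply: eq_bigr => q _; rewrite /gen /deg enum_rankK.
  apply: eq_bigr => k _; rewrite ffunE [in LHS](sum_comp (vbasis (gs_sub G))`_k).
  by rewrite sum_ffunE scaler_sumr.
have -> : [ffun a => (w *m cover_mx) 0 a] = \sum_p [ffun a => w 0 p * gen p a].
  apply/ffunP => a; rewrite ffunE mxE sum_ffunE; apply: eq_bigr => p _.
  by rewrite !ffunE mxE !ffunE.
by apply: memv_suml => p _; apply: gs_left.
Qed.

Let ker_map (w : V rk) : V (gs_rank G) :=
  [ffun a => \sum_p w p * cover_mx p a].

Let ker_map_is_linear : linear ker_map.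
Proof.
move=> c u v; apply/ffunP => a; rewrite !ffunE scaler_sumr -big_split.
by apply: eq_bigr => p _; rewrite !ffunE /= mulrDl scalerAl.
Qed.

HB.instance Definition _ := GRing.isLinear.Build K (V rk) (V (gs_rank G))
  *:%R ker_map ker_map_is_linear.

Let ker : {vspace V rk} := lker (linfun ker_map).

Let kerP (w : V rk) :
  reflect (forall a, \sum_p w p * cover_mx p a = 0) (w \in ker).
Proof.
rewrite memv_ker lfunE /=; apply: (iffP eqP) => [/ffunP h a|h].
  by have := h a; rewrite !ffunE.
by apply/ffunP => a; rewrite !ffunE.
Qed.

Let ker_left x v : v \in ker -> [ffun a => x * v a] \in ker.
Proof.
move=> /kerP h; apply/kerP => a; apply: etrans (mulr0 x); rewrite -[in RHS](h a) mulr_sumr.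
by apply: eq_bigr => p _; rewrite ffunE mulrA.
Qed.

Let ker_comp d v : v \in ker -> shift_comp deg d v \in ker.
Proof.
move=> /kerP h; apply/kerP => a; apply/ffunP => U; rewrite sum_ffunE [RHS]ffunE.
have := congr1 (fun x : E => if (#|U| + gs_deg a)%N == d then x U else 0) (h a).
rewrite sum_ffunE ffunE if_same; apply: etrans.
rewrite (eq_bigr (fun p => if (#|U| + gs_deg a)%N == d then
  (v p * cover_mx p a) U else 0)) => [|p _].
  by case: ifP => // _; rewrite big1.
rewrite !ffunE; under eq_bigr => S SU do rewrite !ffunE.
case: ifP => Ud; [apply: eq_bigr => S SU | apply: big1 => S SU].
all: have [->|/cover_homog] := eqVneq (cover_mx p a (U :\: S)) 0;
  rewrite ?mulr0 // => e; have := cardsID S U; rewrite (setIidPr SU) => eU.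
  by rewrite (_ : _ == d) //; move/eqP: Ud; lia.
by rewrite (_ : (_ == d) = false) ?mulr0 ?mul0r //; move/eqP: Ud; lia.
Qed.

Definition syzygies : graded_sub := @GradedSub rk deg ker ker_left ker_comp.

Lemma syzygiesP (w : 'rV[E]_(gs_rank syzygies)) :
  ([ffun a => w 0 a] \in gs_sub syzygies) <-> w *m cover_mx = 0.
Proof.
split=> [/kerP h|h].
  apply/rowP => a; rewrite !mxE; apply: etrans (h a); apply: eq_bigr => p _.
  by rewrite ffunE.
apply/kerP => a; have := congr1 (fun M : 'rV__ => M 0 a) h; rewrite !mxE.
apply: etrans.
by apply: eq_bigr => p _; rewrite ffunE.
Qed.

End Cover.

Variable I : {vspace E}.
Hypothesis I_left : forall x y, y \in I -> x * y \in I.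
Hypothesis I_graded : forall d y, y \in I -> ext_comp d y \in I.

Let ev0 (v : V 1) : E := v 0.

Let ev0_is_linear : linear ev0.
Proof. by move=> c u v; rewrite /ev0 !ffunE. Qed.

HB.instance Definition _ := GRing.isLinear.Build K (V 1) E *:%R ev0 ev0_is_linear.

Let sub0 : {vspace V 1} := (linfun ev0 @^-1: I)%VS.

Let sub0E v : (v \in sub0) = (v 0 \in I).
Proof. by rewrite -memv_preim lfunE. Qed.

Let sub0_left x v : v \in sub0 -> [ffun a => x * v a] \in sub0.
Proof. by rewrite !sub0E ffunE => /I_left. Qed.

Let sub0_comp d v : v \in sub0 -> shift_comp (fun=> 0%N) d v \in sub0.
Proof.
rewrite !sub0E ffunE => vI; rewrite (_ : finfun _ = ext_comp d (v 0)).
  exact: I_graded.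
by apply/ffunP => S; rewrite !ffunE addn0.
Qed.

Definition free_resolution_iter i : graded_sub :=
  iter i syzygies (GradedSub sub0_left sub0_comp).

Theorem free_resolution_exists : inhabited (free_resolution I).
Proof.
pose G := free_resolution_iter.
have mul1mx1 (v : 'rV[E]_1) : (v *m (1%:M : 'cV[E]_1)) 0 0 = v 0 0.
  by rewrite mulmx1.
have G0P (v : 'rV[E]_1) :
  (v *m (1%:M : 'cV[E]_1)) 0 0 \in I <-> exists w, v = w *m cover_mx (G 0).
  by rewrite -cover_mxP sub0E ffunE mul1mx1.
constructor; apply: (@FreeResolution K n I (fun i => gs_rank (G i))
  (fun i => @gs_deg (G i)) 1%:M (fun i => cover_mx (G i))) => //.
- move=> a S; rewrite !ord1 mxE /= ffunE.
  by case: (eqVneq S set0) => [->|_]; rewrite ?cards0 // eqxx.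
- by move=> i a b S /cover_homog.
- by move=> x; exists (const_mx x); rewrite mul1mx1 mxE subrr mem0v.
- by move=> i v; rewrite -syzygiesP cover_mxP.
Qed.

End FreeResolutionExists.

Section OSResolution.
Variables (F : fieldType) (l n : nat) (A : arrangement F l n) (K : fieldType).
Local Notation E := (exterior K n).

Let ext_homogM p q (x y : E) :
  ext_homog p x -> ext_homog q y -> ext_homog (p + q) (x * y).
Proof.
move=> hx hy U; rewrite ffunE => /eqP Uxy.
have [S /andP[SU]] : exists S : {set 'I_n}, (S \subset U) && (x S * y (U :\: S) != 0).
  apply/existsP; apply: contra_notT Uxy => /existsPn h; apply: big1 => S SU.
  by have := h S; rewrite SU /= negbK => /eqP xy0; rewrite -mulrA xy0 mulr0.
rewrite mulf_eq0 negb_or => /andP[/hx <- /hy <-].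
by rewrite -(cardsID S U) (setIidPr SU).
Qed.

Let ext_homog_basis (S : {set 'I_n}) : ext_homog #|S| (ext_basis K S).
Proof. by move=> T; rewrite ffunE; case: (eqVneq T S) => [->|]; rewrite ?eqxx. Qed.

Let ext_homog_diff (J : {set 'I_n}) : ext_homog #|J|.-1 (ext_diff (ext_basis K J)).
Proof.
move=> T; apply: contraNeq => TJ; rewrite sum_ffunE big1 // => S _.
rewrite !ffunE; case: eqVneq => [->|]; last by rewrite scale0r.
rewrite sum_ffunE big1 ?scaler0 // => i iJ; rewrite !ffunE.
case: eqVneq => [Ti|]; last by rewrite scaler0.
by case/eqP: TJ; rewrite Ti [in RHS](cardsD1 i J) iJ.
Qed.

Let prodv_span (X Y : seq E) :
  (<<X>> * <<Y>>)%VS = <<[seq (x * y)%R | x <- X, y <- Y]>>%VS.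
Proof.
apply/eqP; rewrite eqEsubv; apply/andP; split.
  apply/prodvP => x y xX yY.
  rewrite (@coord_span _ _ _ (in_tuple X) _ xX) (@coord_span _ _ _ (in_tuple Y) _ yY).
  rewrite mulr_suml; apply: memv_suml => i _; rewrite mulr_sumr.
  apply: memv_suml => j _; rewrite -scalerAl -scalerAr.
  by do 2!apply: memvZ; apply/memv_span/allpairs_f; apply: mem_nth.
apply/span_subvP => _ /allpairsP[[x y] /= [xX yY ->]].
by apply: memv_mul; apply: memv_span.
Qed.

Let B := [seq ext_basis K J | J : {set 'I_n}].

Let G := [seq ext_diff (ext_basis K J) | J in dependent A].

Let fullvE : fullv = <<B>>%VS :> {vspace E}.
Proof.
apply/eqP; rewrite eqEsubv subvf andbT; apply/subvP => x _.
rewrite [x]ext_sum_basis; apply: memv_suml => S _; apply/memvZ/memv_span.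
by rewrite map_f ?mem_enum.
Qed.

Let ext_comp_is_linear d : linear (@ext_comp K n d).
Proof.
move=> c x y; apply/ffunP => S; rewrite !ffunE; case: ifP => // _.
by rewrite scaler0 addr0.
Qed.

HB.instance Definition _ d := GRing.isLinear.Build K E E *:%R
  (@ext_comp K n d) (ext_comp_is_linear d).

Theorem OS_resolution_exists : inhabited (free_resolution (OS_ideal A K)).
Proof.
apply: free_resolution_exists => [x y yI|d y].
  have := memv_mul (memvf x) yI; apply: subvP.
  by rewrite /OS_ideal !prodvA; do 2!apply: prodvSl; apply: subvf.
rewrite /OS_ideal fullvE !prodv_span => yI.
have := memv_img (linfun (@ext_comp K n d)) yI; rewrite lfunE /=; apply: subvP.
rewrite limg_span; apply/span_subvP => _ /mapP[z zI ->]; rewrite lfunE /=.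
have [e he] : exists e, ext_homog e z.
  case/allpairsP: zI => -[u v] /= [/allpairsP[[x g] /= [xB gG ->]] vB ->].
  case/mapP: xB => S _ ->; case/mapP: gG => J _ ->; case/mapP: vB => T _ ->.
  by eexists; apply: ext_homogM; [apply: ext_homogM|]; 
    [apply: ext_homog_basis | apply: ext_homog_diff | apply: ext_homog_basis].
have [de|de] := eqVneq e d.
  rewrite (_ : ext_comp d z = z) ?memv_span //; apply/ffunP => S; rewrite ffunE.
  by case: eqVneq => // Sd; apply/esym/eqP; apply: contraNT Sd => /he ->; apply/eqP.
rewrite (_ : ext_comp d z = 0) ?mem0v //; apply/ffunP => S; rewrite !ffunE.
case: eqVneq => // Sd; apply/eqP; apply: contraNT de => /he <-; exact/eqP.
Qed.

End OSResolution.

(* Main.v *)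
(* The Tor modules of A = E/I are computed from the Koszul complex: if D_q is the
   q-th divided power of the span of the x_k, then Tor_i^E(A, K)_j is the homology
   at A_(j-i) (x) D_i of d = sum_k e_k d/dx_k.  The comparison with a given free
   resolution is dimension shifting along the kernels of its differentials, the
   Koszul complex of a free module being acyclic by Euler's homotopy.

   Linear strand.  Tor_i(A)_(i+1) is the space of closed 2-forms of polynomial
   degree i - 1 with values in I_2.  An element x of E_2 is the sum of its
   restrictions to the pencils X in L_2, and it lies in I_2 iff each restriction is
   killed by the derivation; hence the forms that only involve the variables
   and generators of a single pencil contribute the direct sum of the local strands.
   MLS says that there is nothing else for i = 2.  A form is local as soon as its
   derivatives are, and derivatives of closed I_2-valued forms are again such, so
   there is nothing else for i > 2 either.  A local strand is the image under d of
   the 1-forms killed by the derivation and by sum_k d/dx_k.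

   Second row.  In rank 3 the ideal contains E_4, so that x in E_3 lies in I iff
   its derivation does; this gives dim A_3, and also the surjectivity of d onto
   A_3 (x) D, since the derivation anticommutes with d up to sum_k d/dx_k.  The Euler
   characteristic of the internal degree i + 2 part of the Koszul complex is then the
   formula. *)
From HB Require Import structures.
Require Import Defs.
From mathcomp Require Import all_boot all_order all_algebra all_field.
From mathcomp Require Import ring zify.
From mathcomp Require Import reals complex.
Set Implicit Arguments.
Unset Strict Implicit.
Unset Printing Implicit Defensive.
Import GRing.Theory.
Local Open Scope ring_scope.

(** * Dimensions of subspaces *)

Section LinearAlgebra.
Variable K : fieldType.
Implicit Types (V W : vectType K).

(** The linearity proof is an argument, so that a local function without a declared instance still
    gets a canonical linear structure. *)
Definition lfun_of V W (f : V -> W) of linear f := f.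
HB.instance Definition _ V W f lf :=
  GRing.isLinear.Build K V W *:%R (@lfun_of V W f lf) lf.
Definition mklfun V W (f : V -> W) (lf : linear f) : 'Hom(V, W) := linfun (lfun_of lf).
Lemma mklfunE V W (f : V -> W) (lf : linear f) x : mklfun lf x = f x.
Proof. by rewrite lfunE. Qed.

Lemma memv_linfun_img V W (f : {linear V -> W}) x (U : {vspace V}) :
  x \in U -> f x \in (linfun f @: U)%VS.
Proof. by move=> xU; rewrite -(lfunE f) memv_img. Qed.

(** The induced map U1/U2 -> f(U1)/f(U2) is bijective because U2 contains the kernel of f on U1.
    Homology is treated throughout as a difference of dimensions, and two such differences are
    compared in this way. *)
Lemma dim_subquotient_img V W (f : 'Hom(V, W)) (U1 U2 : {vspace V}) :
  (U2 <= U1)%VS -> (U1 :&: lker f <= U2)%VS ->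
  (\dim U1 - \dim U2 = \dim (f @: U1) - \dim (f @: U2))%N.
Proof.
move=> U21 kU; have e : (U1 :&: lker f = U2 :&: lker f)%VS.
  apply/eqP; rewrite eqEsubv subv_cap kU capvSr /=.
  by rewrite subv_cap capvSr andbT (subv_trans (capvSl _ _)).
have := limg_ker_dim f U1; have := limg_ker_dim f U2; rewrite e; lia.
Qed.

(** Rank-nullity on [U :&: f @^-1: Z], whose image is [f @: U :&: Z], combined with the dimension
    formula for a sum. It counts cycles modulo Z in the Euler characteristic. *)
Lemma dim_preim_cap V W (f : 'Hom(V, W)) (U : {vspace V}) (Z : {vspace W}) :
  (\dim (U :&: f @^-1: Z) + \dim (f @: U + Z) = \dim U + \dim Z)%N.
Proof.
have e1 := dimv_sum_cap (f @: U) Z; have e2 := limg_ker_dim f U.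
have e3 := limg_ker_dim f (U :&: f @^-1: Z).
have k : (U :&: f @^-1: Z :&: lker f = U :&: lker f)%VS.
  apply/vspaceP => x; rewrite !memv_cap -memv_preim memv_ker.
  by case: eqP => [->|]; rewrite ?andbF ?mem0v ?andbT.
have i : (f @: (U :&: f @^-1: Z) = f @: U :&: Z)%VS.
  apply/vspaceP => y; apply/memv_imgP/idP => [[x + ->]|].
    by rewrite memv_cap -memv_preim => /andP[xU xZ]; rewrite memv_cap memv_img.
  rewrite memv_cap => /andP[/memv_imgP[x xU ->] xZ].
  by exists x => //; rewrite memv_cap xU -memv_preim.
move: e3; rewrite k i; lia.
Qed.

(** Such an f stands in for the quotient map V -> V/N. *)
Lemma lker_exists V (N : {vspace V}) : exists f : 'End(V), lker f = N.
Proof.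
exists (\1 - projv N)%VF; apply/vspaceP => x;
  rewrite memv_ker add_lfunE opp_lfunE id_lfunE subr_eq0.
by apply/eqP/idP => [->|/projv_id ->//]; exact: memv_proj.
Qed.

Section Pointwise.
Variables (T : finType) (W : vectType K).
Implicit Type U : T -> {vspace W}.

Fact ffun_ev_linear (t : T) : linear (fun f : {ffun T -> W} => f t).
Proof. by move=> a f g; rewrite !ffunE. Qed.

Definition ffun_ev t := mklfun (ffun_ev_linear t).

Definition pointwise U : {vspace {ffun T -> W}} := (\bigcap_t (ffun_ev t @^-1: U t))%VS.

Lemma pointwiseP U (f : {ffun T -> W}) : reflect (forall t, f t \in U t)
  (f \in pointwise U).
Proof.
rewrite memvE; apply: (iffP subv_bigcapP) => h t.
  by have := h t isT; rewrite -memvE -memv_preim mklfunE.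
by move=> _; rewrite -memvE -memv_preim mklfunE.
Qed.

Lemma dim_pointwise U : \dim (pointwise U) = (\sum_t \dim (U t))%N.
Proof.
(* Induction on the list of coordinates that are allowed to be nonzero. *)
have main (s : seq T) : uniq s ->
    \dim (pointwise (fun t => if t \in s then U t else 0%VS)) = (\sum_(t <- s) \dim (U t))%N.
  elim: s => [_|a s IH /= /andP[ans us]].
    rewrite big_nil; apply/eqP; rewrite dimv_eq0 -subv0; apply/subvP => f /pointwiseP /= h.
    by rewrite memv0; apply/eqP/ffunP => t; have := h t; rewrite memv0 => /eqP ->;
      rewrite ffunE.
  rewrite big_cons -(IH us) -(limg_ker_dim (ffun_ev a)) addnC; congr (_ + _)%N;
    congr (\dim _).
    apply/vspaceP => y; apply/memv_imgP/idP => [[f /pointwiseP /(_ a)]|yU].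
      by rewrite mem_head => ? ->; rewrite mklfunE.
    exists [ffun t => if t == a then y else 0]; last by rewrite mklfunE ffunE eqxx.
    apply/pointwiseP => t; rewrite ffunE in_cons; case: eqP => [->|_] //=.
    exact: mem0v.
  apply/vspaceP => f; rewrite memv_cap memv_ker mklfunE; apply/andP/pointwiseP.
    move=> [/pointwiseP h /eqP fa] t; have := h t; rewrite in_cons.
    by case: eqP => [->|_ /=]; rewrite ?(negPf ans) ?fa ?mem0v.
  move=> h; split; last by have := h a; rewrite (negPf ans) memv0.
  apply/pointwiseP => t; have := h t; rewrite in_cons; case: eqP => [->|//] /=.
  by rewrite (negPf ans) memv0 => /eqP ->; rewrite mem0v.
rewrite -big_enum -(main _ (enum_uniq _)); congr (\dim _); apply/vspaceP => f.
by apply/pointwiseP/pointwiseP => h t; have := h t; rewrite mem_enum.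
Qed.

End Pointwise.

Section CoordinateSubspace.
Variable T : finType.
Implicit Type P : pred T.

Definition coord_subspace P : {vspace {ffun T -> K^o}} :=
  pointwise (fun t => if P t then fullv else 0%VS).

Lemma coord_subspaceP P (f : {ffun T -> K^o}) :
  reflect (forall t, f t != 0 -> P t) (f \in coord_subspace P).
Proof.
apply: (iffP (pointwiseP _ _)) => h t; have := h t; case: (P t) => //.
- by rewrite memv0 => ->.
- by rewrite memvf.
- by case: eqP => [->|_ /(_ isT)//]; rewrite mem0v.
Qed.

Lemma dim_coord_subspace P : \dim (coord_subspace P) = #|P|.
Proof.
rewrite dim_pointwise -sum1_card [RHS]big_mkcond; apply: eq_bigr => t _.
by rewrite unfold_in; case: (P t); rewrite ?dimv0 // dimvf.
Qed.

End CoordinateSubspace.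
End LinearAlgebra.

(** * Monomials *)

(** Bounding each exponent by the degree q makes the type finite, so that forms of a fixed
    polynomial degree make up a finite-dimensional space. *)
Record mon (n q : nat) := Mon {
  mon_val : {ffun 'I_n -> 'I_q.+1};
  _ : (\sum_i (mon_val i : nat) == q)%N }.

HB.instance Definition _ n q := [isSub for @mon_val n q].
HB.instance Definition _ n q := [Finite of mon n q by <:].

Section Monomials.
Variable n : nat.
Implicit Types (k l : 'I_n) (X : {set 'I_n}).

Definition expo q (t : mon n q) k : nat := mon_val t k.

Lemma sum_expo q (t : mon n q) : (\sum_k expo t k = q)%N.
Proof. by rewrite /expo; case: t => a /= /eqP. Qed.

Lemma expo_inj q (s t : mon n q) : expo s =1 expo t -> s = t.
Proof. by move=> e; apply/val_inj/ffunP => k; apply/val_inj/e. Qed.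

Lemma mon_of_expo q (a : 'I_n -> nat) : (\sum_k a k = q)%N ->
  {t : mon n q | expo t =1 a}.
Proof.
move=> sa; have le k : (a k < q.+1)%N by rewrite ltnS -sa (bigD1 k) //= leq_addr.
have e : (\sum_k ([ffun k => Ordinal (le k)] k : nat) == q)%N.
  by rewrite -[X in _ == X]sa; apply/eqP; apply: eq_bigr => k _; rewrite ffunE.
by exists (Mon e) => k; rewrite /expo /= ffunE.
Qed.

Fact mon_add_subproof q k (t : mon n q) : (\sum_i ((i == k) + expo t i) = q.+1)%N.
Proof.
rewrite big_split /= sum_expo (bigD1 k) //= eqxx big1 ?addn0 // => i.
by move/negPf->.
Qed.

Definition mon_add q k (t : mon n q) : mon n q.+1 :=
  sval (mon_of_expo (mon_add_subproof k t)).

Lemma expo_add q k (t : mon n q) i : expo (mon_add k t) i = ((i == k) + expo t i)%N.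
Proof. by rewrite /mon_add; case: mon_of_expo. Qed.

Lemma mon_addC q k l (t : mon n q) : mon_add k (mon_add l t) = mon_add l (mon_add k t).
Proof. by apply: expo_inj => i; rewrite !expo_add addnCA. Qed.

Lemma mon_add_inj q k : injective (@mon_add q k).
Proof.
move=> s t st; apply: expo_inj => i; apply/eqP; rewrite -(eqn_add2l (i == k)).
by rewrite -!expo_add st.
Qed.

Lemma mon_addP q k (t : mon n q.+1) : expo t k != 0%N -> exists s, t = mon_add k s.
Proof.
move=> tk; have sa : (\sum_i (expo t i - (i == k)) = q)%N.
  apply: succn_inj; apply: etrans (sum_expo t); rewrite -addn1.
  have <- : (\sum_i (i == k) = 1)%N.
    by rewrite (bigD1 k) //= eqxx big1 ?addn0 // => i /negPf ->.
  rewrite -big_split; apply: eq_bigr => i _ /=.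
  by case: eqP => [->|_]; lia.
have [s es] := mon_of_expo sa; exists s; apply: expo_inj => i.
by rewrite expo_add es; case: eqP => [->|_]; lia.
Qed.

Lemma mon_succ q (t : mon n q.+1) : exists k s, t = mon_add k s.
Proof.
have [k tk|t0] := pickP (fun k => expo t k != 0%N).
  by have [s ->] := mon_addP tk; exists k, s.
have := sum_expo t; rewrite big1 // => k _.
by have /negbFE/eqP := t0 k.
Qed.

Lemma mon0_all_equal (s t : mon n 0) : s = t.
Proof. by apply: expo_inj => k; rewrite /expo !ord1. Qed.

Fact mon0_subproof : (\sum_(k < n) 0 = 0)%N.
Proof. exact: big1_eq. Qed.

Definition mon0 : mon n 0 := sval (mon_of_expo mon0_subproof).

Definition mon_in X q (t : mon n q) := [forall k, (expo t k != 0%N) ==> (k \in X)].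

Lemma mon_in0 X (t : mon n 0) : mon_in X t.
Proof. by apply/forallP => k; rewrite /expo ord1. Qed.

Lemma mon_inT q (t : mon n q) : mon_in setT t.
Proof. by apply/forallP => k; rewrite inE implybT. Qed.

Lemma mon_in_add X q k (t : mon n q) : mon_in X (mon_add k t) = (k \in X) && mon_in X t.
Proof.
apply/forallP/andP => [h|[kX /forallP h] i].
  split; first by have := h k; rewrite expo_add eqxx.
  by apply/forallP => i; apply/implyP => ti; have := h i;
    rewrite expo_add addn_eq0 negb_and ti orbT.
by rewrite expo_add addn_eq0 negb_and; have [->|_] := eqVneq i k; [rewrite kX | exact: h].
Qed.

Lemma mon_inPn X q (t : mon n q.+1) : ~~ mon_in X t ->
  exists2 k, k \notin X & exists s, t = mon_add k s.
Proof.
case/forallPn => k; rewrite negb_imply => /andP[tk kX].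
by exists k => //; exact: mon_addP.
Qed.

(** Pascal's rule: for k in X, a monomial of degree q + 1 either avoids x_k or is x_k times one of
    degree q. For empty X the truncated [- 1] gives 1 in degree 0 and 0 in positive degree, as it
    should. *)
Lemma card_mon_in X q : #|[pred t : mon n q | mon_in X t]| = 'C(#|X| + q - 1, q).
Proof.
elim: q X => [|q IHq] X.
  rewrite bin0 (@eq_card1 _ mon0) // => t; rewrite !inE mon_in0; apply/esym/eqP.
  exact: mon0_all_equal.
move cX: #|X| => m; elim: m X cX => [|m IHm] X cX.
  rewrite add0n subn1 /= bin_small // eq_card0 // => t; rewrite !inE.
  have [k [s ->]] := mon_succ t.
  by rewrite mon_in_add (cards0_eq cX) inE.
have [k kX] : exists k, k \in X by apply/card_gt0P; rewrite cX.
have cXk : #|X :\ k| = m by move: cX; rewrite (cardsD1 k X) kX => -[].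
have -> : #|[pred t : mon n q.+1 | mon_in X t]| =
    (#|[pred t : mon n q.+1 | mon_in (X :\ k) t]| + #|[pred t : mon n q | mon_in X t]|)%N.
  rewrite -(cardID [pred t : mon n q.+1 | expo t k == 0%N]); congr (_ + _)%N.
    apply: eq_card => t; rewrite !inE; apply/andP/forallP.
      move=> [/forallP h /eqP tk] i; apply/implyP => ti; rewrite !inE (implyP (h i)) //.
      by rewrite andbT; apply: contraNneq ti => ->; rewrite tk.
    move=> h; split.
      by apply/forallP => i; apply/implyP => /(implyP (h i)); rewrite !inE => /andP[].
    by apply: contraTT isT => /(implyP (h k)); rewrite !inE eqxx.
  rewrite -(card_image (@mon_add_inj q k)); apply: eq_card => t; rewrite !inE.
  apply/andP/imageP => [[tk]|[s + ->]].
    have [s ->] := mon_addP tk; rewrite mon_in_add => /andP[_ sX].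
    by exists s; rewrite ?inE.
  by rewrite !inE mon_in_add kX expo_add eqxx.
rewrite (IHm _ cXk) IHq cX.
by rewrite (_ : m.+1 + q.+1 - 1 = (m + q).+1)%N ?binS; [congr ('C(_, _) + 'C(_, _))%N|];
  lia.
Qed.

Lemma card_mon q : #|{: mon n q}| = 'C(n + q - 1, q).
Proof.
have := card_mon_in setT q; rewrite cardsT card_ord => <-.
by apply: eq_card => t; rewrite !inE mon_inT.
Qed.

End Monomials.

(** * Differentiation and multiplication by variables on divided powers *)

Section DerivativesOfPolynomials.
Variables (K : fieldType) (n : nat) (W : lmodType K).
Implicit Types (k l : 'I_n) (X : {set 'I_n}).
Local Notation pol q := {ffun mon n q -> W}.

(* [f t] is read as the coefficient of the divided power x^(t), so that [pder k]
   is d/dx_k and [pmul k] is multiplication by x_k. *)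
Definition pder q k (f : pol q.+1) : pol q := [ffun t => f (mon_add k t)].

Definition pmul q k (f : pol q) : pol q.+1 :=
  [ffun t => (expo t k)%:R *: \sum_(s | mon_add k s == t) f s].

Lemma pderE q k (f : pol q.+1) t : pder k f t = f (mon_add k t).
Proof. by rewrite ffunE. Qed.

Lemma pmul_add q k (f : pol q) t : pmul k f (mon_add k t) = (expo t k).+1%:R *: f t.
Proof.
rewrite ffunE expo_add eqxx add1n (bigD1 t) //= big1 ?addr0 // => s /andP[/eqP st].
by rewrite (mon_add_inj st) eqxx.
Qed.

Lemma pmul0 q k (f : pol q) t : expo t k = 0%N -> pmul k f t = 0.
Proof. by move=> tk; rewrite ffunE tk scale0r. Qed.

Lemma pder_pmul0 k l (f : pol 0) t : pder l (pmul k f) t = (k == l)%:R *: f t.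
Proof.
rewrite pderE; have [->|kl] := eqVneq k l.
  by rewrite pmul_add /expo ord1.
by rewrite scale0r pmul0 // expo_add (negPf kl) /expo ord1.
Qed.

Lemma pder_pmul q k l (f : pol q.+1) t :
  pder l (pmul k f) t = (k == l)%:R *: f t + pmul k (pder l f) t.
Proof.
rewrite pderE; have [tk|/mon_addP[s ->]] := eqVneq (expo t k) 0%N.
  rewrite [X in _ + X]pmul0 // addr0; have [<-|kl] := eqVneq k l.
    by rewrite pmul_add tk.
  by rewrite scale0r pmul0 // expo_add (negPf kl).
rewrite pmul_add pderE; have [<-|kl] := eqVneq k l.
  by rewrite pmul_add expo_add eqxx -scalerDl -natrD.
by rewrite mon_addC pmul_add scale0r add0r expo_add (negPf kl).
Qed.

Lemma pmul_pder q k (f : pol q.+1) t : pmul k (pder k f) t = (expo t k)%:R *: f t.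
Proof.
have [tk|/mon_addP[s ->]] := eqVneq (expo t k) 0%N.
  by rewrite pmul0 // tk scale0r.
by rewrite pmul_add pderE expo_add eqxx.
Qed.

End DerivativesOfPolynomials.

(** * Contractions *)

Section Contraction.
Variables (K : fieldType) (n : nat).
Local Notation E := (exterior K n).
Implicit Types (k l : 'I_n) (S U : {set 'I_n}) (x y : E).

Lemma ninv1U k l U : l \notin U ->
  ninv [set k] (l |: U) = ((l < k) + ninv [set k] U)%N.
Proof. by move=> lU; rewrite ninvUr ?disjoints1 // /ninv !big_set1. Qed.

Lemma ninv1UD k l U : l \in U ->
  ninv [set k] U = ((l < k) + ninv [set k] (U :\ l))%N.
Proof. by move=> lU; rewrite -{1}(setD1K lU) ninv1U // !inE eqxx. Qed.

Lemma ext_gen_mulE k x U : (ext_gen K k * x) U =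
  if k \in U then (-1) ^+ ninv [set k] (U :\ k) * x (U :\ k) else 0.
Proof.
rewrite [LHS]ffunE; case: ifP => kU.
  rewrite (bigD1 [set k]) ?sub1set //= big1 => [|S /andP[_ /negbTE Sk]].
    by rewrite ffunE eqxx addr0 mulr1.
  by rewrite ffunE Sk mulr0 mul0r.
rewrite big1 // => S SU; rewrite ffunE; case: eqVneq => [Sk|]; last first.
  by rewrite mulr0 mul0r.
by rewrite Sk sub1set kU in SU.
Qed.

(** Interior product with the k-th vector of the dual basis. *)
Definition contract k x : E :=
  [ffun U : {set 'I_n} => if k \in U then 0 else (-1) ^+ ninv [set k] U * x (k |: U) : K^o].

Fact contract_is_linear k : linear (contract k).
Proof.
move=> a x y; apply/ffunP => U; rewrite !ffunE; case: ifP => _.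
  by rewrite scaler0 addr0.
by rewrite mulrDr /GRing.scale /= mulrCA.
Qed.

HB.instance Definition _ k :=
  GRing.isLinear.Build K E E *:%R (contract k) (contract_is_linear k).

Lemma wedge_contract k l x :
  ext_gen K k * contract l x + contract l (ext_gen K k * x) = (k == l)%:R *: x.
Proof.
apply/ffunP => U; rewrite [in LHS]ffunE ext_gen_mulE ![contract _ _ _]ffunE.
rewrite [in RHS]ffunE ext_gen_mulE !inE; have [<-|kl] := eqVneq k l.
  rewrite ?eqxx /= scale1r; case: ifP => kU.
    by rewrite setD1K // addr0 mulrA -expr2 sqrr_sign mul1r.
  by rewrite setU1K ?kU // add0r mulrA -expr2 sqrr_sign mul1r.
rewrite scale0r /=; case: ifP => kU; last by case: ifP; rewrite !(mulr0, addr0).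
case: ifP => lU; first by rewrite mulr0 addr0.
have lUk : l \notin U :\ k by rewrite !inE lU andbF.
have -> : (l |: U) :\ k = l |: U :\ k.
  by apply/setP => i; rewrite !inE; case: (eqVneq i l) => [->|]; rewrite // eq_sym kl.
rewrite (ninv1UD _ kU) (ninv1U _ lUk) !exprD.
(* The two terms differ by exactly one sign, since exactly one of k < l and l < k holds. *)
move: kl; rewrite -val_eqE /=; case: ltngtP => //= _ _; rewrite ?expr0 ?expr1; ring.
Qed.

Lemma contract_anticomm k l x : contract k (contract l x) = - contract l (contract k x).
Proof.
apply/ffunP => U; rewrite [in RHS]ffunE !ffunE !inE.
have [<-|kl] := eqVneq k l; first by rewrite ?eqxx /=; case: ifP => _; rewrite ?mulr0 oppr0.
rewrite /=.
case: ifP => kU; case: ifP => lU; rewrite ?mulr0 ?oppr0 //.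
rewrite setUCA !ninv1U ?kU ?lU // !exprD.
move: kl; rewrite -val_eqE /=; case: ltngtP => //= _ _; rewrite ?expr0 ?expr1; ring.
Qed.

Lemma wedge_anticomm k l x : ext_gen K k * (ext_gen K l * x) = - (ext_gen K l * (ext_gen K k * x)).
Proof.
apply/ffunP => U; rewrite [in RHS]ffunE !ext_gen_mulE !inE.
have [<-|kl] := eqVneq k l; first by rewrite ?eqxx /=; case: ifP => _; rewrite ?mulr0 oppr0.
rewrite /=.
case: ifP => kU; case: ifP => lU; rewrite ?mulr0 ?oppr0 //.
have e : U :\ l :\ k = U :\ k :\ l by rewrite !setDDl setUC.
have lUk : l \in U :\ k by rewrite !inE lU andbT eq_sym.
have kUl : k \in U :\ l by rewrite !inE kU andbT.
rewrite (ninv1UD k lUk) (ninv1UD l kUl) e !exprD.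
move: kl; rewrite -val_eqE /=; case: ltngtP => //= _ _; rewrite ?expr0 ?expr1; ring.
Qed.

(** The number operator of the exterior algebra: each k in U contributes x U once, each other k
    nothing. *)
Lemma sum_wedge_contract x U : (\sum_k ext_gen K k * contract k x) U = #|U|%:R * x U.
Proof.
rewrite sum_ffunE -sum1_card natr_sum mulr_suml [RHS]big_mkcond; apply: eq_bigr => k _.
rewrite ext_gen_mulE ffunE !inE eqxx /=; case: ifP => kU //.
by rewrite setD1K // mulrA -expr2 sqrr_sign.
Qed.

Lemma ext_diff_wedge k x : ext_diff (ext_gen K k * x) = x - ext_gen K k * ext_diff x.
Proof.
rewrite (@ext_diffM _ _ 1) ?ext_diff_gen ?mul1r ?expr1 ?mulN1r // => S.
by rewrite ffunE; case: (eqVneq S [set k]) => [->|]; rewrite ?cards1 ?eqxx.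
Qed.

Lemma ext_homog1 : ext_homog 0 (1 : E).
Proof. by move=> S; rewrite ffunE; case: (eqVneq S set0) => [->|]; rewrite ?cards0 ?eqxx.
Qed.

Lemma contract1 k : contract k 1 = 0.
Proof.
apply/ffunP => U; rewrite !ffunE; case: ifP => // _.
case: eqVneq => [/setP /(_ k)|_]; last by rewrite mulr0.
by rewrite !inE eqxx.
Qed.

Lemma ext_diff1 : ext_diff (1 : E) = 0.
Proof.
have := ext_diffM 1 ext_homog1; rewrite !mul1r mulr1.
by move/eqP; rewrite -subr_eq subrr eq_sym => /eqP.
Qed.

(** The derivation is the interior product with the functional that sends every e_k to 1. Both sides
    obey the same Leibniz rule for multiplication by a generator, so induction on products of
    generators suffices. *)
Lemma ext_diffE x : ext_diff x = \sum_k contract k x.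
Proof.
have prodE (s : seq 'I_n) : let z : E := \prod_(i <- s) ext_gen K i in
    ext_diff z = \sum_k contract k z.
  elim: s => [|i s IHs] /=.
    by rewrite big_nil ext_diff1 big1 // => k _; rewrite contract1.
  rewrite big_cons ext_diff_wedge IHs; set z := \prod_(i <- s) _.
  rewrite mulr_sumr (eq_bigr (fun k => (i == k)%:R *: z - contract k (ext_gen K i * z))).
    rewrite sumrB (bigD1 i) //= eqxx scale1r big1 ?addr0 => [|k /negPf ik].
      by rewrite opprB addrC subrK.
    by rewrite eq_sym ik scale0r.
  by move=> k _; rewrite -wedge_contract addrK.
rewrite [x]ext_sum_basis linear_sum.
under [RHS]eq_bigr => k _ do rewrite linear_sum.
rewrite [RHS]exchange_big; apply: eq_bigr => S _ /=; rewrite linearZ /=.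
under [RHS]eq_bigr => k _ do rewrite linearZ /=.
by rewrite -scaler_sumr ext_basisE -big_filter prodE.
Qed.

Lemma ext_diff_contract k x : ext_diff (contract k x) = - contract k (ext_diff x).
Proof.
rewrite !ext_diffE linear_sum -sumrN; apply: eq_bigr => l _.
exact: contract_anticomm.
Qed.

End Contraction.

(** * Koszul forms *)

Section KoszulForms.
Variables (K : fieldType) (n : nat).
Local Notation E := (exterior K n).
Local Notation form q := {ffun mon n q -> E}.
Implicit Types (k l : 'I_n) (S U X : {set 'I_n}).

(* [kos] is the Koszul differential sum_k e_k d/dx_k, and [cokos], which contracts
   with the Euler field sum_k x_k d/dx_k, is its contracting homotopy up to scalars. *)
Definition kos q (f : form q.+1) : form q :=
  [ffun t => \sum_k ext_gen K k * f (mon_add k t)].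

Definition cokos q (f : form q) : form q.+1 :=
  [ffun t => \sum_k contract k (pmul k f t)].

Definition fdiff q (f : form q) : form q := [ffun t => ext_diff (f t)].

(** The derivative sum_k d/dx_k along (1, ..., 1). It is the anticommutator of [fdiff] and [kos], by
    [fdiff_kos]. *)
Definition tder q (f : form q.+1) : form q := [ffun t => \sum_k f (mon_add k t)].

Fact kos_is_linear q : linear (@kos q).
Proof.
move=> a f g; apply/ffunP => t; rewrite !ffunE scaler_sumr -big_split.
by apply: eq_bigr => k _; rewrite !ffunE mulrDr scalerAr.
Qed.
HB.instance Definition _ q :=
  GRing.isLinear.Build K (form q.+1) (form q) *:%R (@kos q) (@kos_is_linear q).

Fact pmul_is_linear q k : linear (@pmul K n E q k).
Proof.
move=> a f g; apply/ffunP => t; rewrite !ffunE scalerA mulrC -scalerA -scalerDr.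
congr (_ *: _); rewrite scaler_sumr -big_split.
by apply: eq_bigr => s _; rewrite !ffunE.
Qed.
HB.instance Definition _ q k :=
  GRing.isLinear.Build K (form q) (form q.+1) *:%R (@pmul K n E q k) (@pmul_is_linear q k).

Fact pder_is_linear q k : linear (@pder K n E q k).
Proof. by move=> a f g; apply/ffunP => t; rewrite !ffunE. Qed.
HB.instance Definition _ q k :=
  GRing.isLinear.Build K (form q.+1) (form q) *:%R (@pder K n E q k) (@pder_is_linear q k).

Fact cokos_is_linear q : linear (@cokos q).
Proof.
move=> a f g; apply/ffunP => t; rewrite !ffunE scaler_sumr -big_split.
by apply: eq_bigr => k _; rewrite linearP !ffunE linearP.
Qed.
HB.instance Definition _ q :=
  GRing.isLinear.Build K (form q) (form q.+1) *:%R (@cokos q) (@cokos_is_linear q).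

Fact fdiff_is_linear q : linear (@fdiff q).
Proof. by move=> a f g; apply/ffunP => t; rewrite !ffunE linearP. Qed.
HB.instance Definition _ q :=
  GRing.isLinear.Build K (form q) (form q) *:%R (@fdiff q) (@fdiff_is_linear q).

Fact tder_is_linear q : linear (@tder q).
Proof.
move=> a f g; apply/ffunP => t; rewrite !ffunE scaler_sumr -big_split.
by apply: eq_bigr => k _; rewrite !ffunE.
Qed.
HB.instance Definition _ q :=
  GRing.isLinear.Build K (form q.+1) (form q) *:%R (@tder q) (@tder_is_linear q).

Lemma pmul_comp q k (u : {linear E -> E}) (f : form q) t :
  pmul k [ffun s => u (f s)] t = u (pmul k f t).
Proof.
rewrite !ffunE linearZ [in RHS]linear_sum; congr (_ *: _).
by apply: eq_bigr => s _; rewrite ffunE.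
Qed.

Lemma pmul_kos q l (f : form q.+1) t :
  pmul l (kos f) t = \sum_k ext_gen K k * pmul l (pder k f) t.
Proof.
rewrite ffunE; under eq_bigr => s _ do rewrite ffunE.
rewrite exchange_big scaler_sumr; apply: eq_bigr => k _ /=.
rewrite ffunE -scalerAr mulr_sumr; congr (_ *: _).
by apply: eq_bigr => s _; rewrite ffunE.
Qed.

Lemma pmul_tder q l (f : form q.+1) t :
  pmul l (tder f) t = \sum_k pmul l (pder k f) t.
Proof.
rewrite ffunE; under eq_bigr => s _ do rewrite ffunE.
rewrite exchange_big scaler_sumr; apply: eq_bigr => k _ /=.
by rewrite ffunE; congr (_ *: _); apply: eq_bigr => s _; rewrite ffunE.
Qed.

Lemma kos_cokos0 (f : form 0) t S : kos (cokos f) t S = #|S|%:R * f t S.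
Proof.
rewrite -sum_wedge_contract ffunE; congr (fun_of_fin _ S); apply: eq_bigr => k _.
rewrite ffunE (bigD1 k) //= -pderE pder_pmul0 eqxx scale1r big1 ?addr0 // => l lk.
by rewrite -pderE pder_pmul0 (negPf lk) scale0r linear0.
Qed.

(* Both composites are sums over k, l; wedging with e_k anticommutes with
   contracting by e_l up to delta_kl, and so only Euler's field
   sum_k x_k d/dx_k and the degree in E survive. *)
Lemma kos_cokos q (f : form q.+1) t S :
  kos (cokos f) t S + cokos (kos f) t S = (#|S| + q.+1)%:R * f t S.
Proof.
transitivity (((\sum_k ext_gen K k * contract k (f t)) + \sum_k pmul k (pder k f) t) S);
  last first.
  rewrite ffunE sum_wedge_contract natrD mulrDl; congr (_ + _).
  under eq_bigr => k _ do rewrite pmul_pder.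
  by rewrite -scaler_suml -natr_sum sum_expo !ffunE.
transitivity ((kos (cokos f) t + cokos (kos f) t) S); first by rewrite [RHS]ffunE.
congr (fun_of_fin _ S); rewrite !ffunE.
under eq_bigr => k _ do rewrite ffunE.
have e1 k : ext_gen K k * (\sum_l contract l (pmul l f (mon_add k t))) =
    ext_gen K k * contract k (f t) + \sum_l ext_gen K k * contract l (pmul l (pder k f) t).
  rewrite mulr_sumr (bigD1 k) //= [X in _ = _ + X](bigD1 k) //= addrA.
  rewrite -pderE pder_pmul eqxx scale1r linearD mulrDr; congr (_ + _).
  apply: eq_bigr => l lk.
  by rewrite -pderE pder_pmul (negPf lk) scale0r add0r.
rewrite (eq_bigr _ (fun k _ => e1 k)) big_split -addrA /=; congr (_ + _).
have -> : \sum_k contract k (pmul k (kos f) t) =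
    \sum_k \sum_l contract l (ext_gen K k * pmul l (pder k f) t).
  rewrite exchange_big; apply: eq_bigr => k _ /=.
  by rewrite pmul_kos linear_sum.
rewrite -big_split; apply: eq_bigr => k _ /=;
  rewrite -big_split (bigD1 k) //= big1 => [|l lk].
  by rewrite wedge_contract eqxx scale1r addr0.
by rewrite wedge_contract eq_sym (negPf lk) scale0r.
Qed.

Lemma fdiff_kos q (f : form q.+1) : fdiff (kos f) = tder f - kos (fdiff f).
Proof.
apply/ffunP => t; rewrite !ffunE linear_sum -sumrB.
by apply: eq_bigr => k _; rewrite /= ext_diff_wedge !ffunE.
Qed.

Lemma fdiff_cokos q (f : form q) : fdiff (cokos f) = - cokos (fdiff f).
Proof.
apply/ffunP => t; rewrite !ffunE linear_sum -sumrN.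
by apply: eq_bigr => k _; rewrite /= ext_diff_contract -pmul_comp.
Qed.

Lemma tder_kos q (f : form q.+2) : tder (kos f) = kos (tder f).
Proof.
apply/ffunP => t; rewrite !ffunE; under eq_bigr => k _ do rewrite ffunE.
rewrite exchange_big; apply: eq_bigr => k _ /=; rewrite ffunE mulr_sumr.
by apply: eq_bigr => l _; rewrite mon_addC.
Qed.

(** Differentiating the coefficient x_k of [cokos] along (1, ..., 1) gives 1 for each k, and the sum
    of the contractions is [ext_diff]. *)
Lemma tder_cokos q (f : form q.+1) : tder (cokos f) = fdiff f + cokos (tder f).
Proof.
apply/ffunP => t; rewrite !ffunE ext_diffE.
under [X in _ + X]eq_bigr => k _ do rewrite pmul_tder linear_sum.
rewrite exchange_big -big_split; apply: eq_bigr => k _ /=.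
rewrite ffunE (bigD1 k) //= [in RHS](bigD1 k) //= -pderE pder_pmul eqxx scale1r linearD addrA.
congr (_ + _); apply: eq_bigr => l lk.
by rewrite -pderE pder_pmul (negPf lk) scale0r add0r.
Qed.

Lemma kos_pder q k (f : form q.+2) : kos (pder k f) = pder k (kos f).
Proof.
apply/ffunP => t; rewrite !ffunE; apply: eq_bigr => l _.
by rewrite ffunE mon_addC.
Qed.

Section CharacteristicZero.
Hypothesis charK : [pchar K] =i pred0.

Lemma natK_neq0 m : (m.+1%:R : K) != 0.
Proof. by have /pcharf0P -> := charK. Qed.

(** Squares of odd operators are shown to vanish by exhibiting them as their own opposites. *)
Lemma eq_opp0 (V : lmodType K) (x : V) : x = - x -> x = 0.
Proof.
move/eqP; rewrite -addr_eq0 -mulr2n -scaler_nat scaler_eq0.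
by rewrite (negPf (natK_neq0 1)) => /eqP.
Qed.

Lemma kos_kos q (f : form q.+2) : kos (kos f) = 0.
Proof.
apply/ffunP => t; rewrite [RHS]ffunE; apply: eq_opp0; rewrite ffunE.
under eq_bigr => k _ do rewrite ffunE mulr_sumr.
rewrite [LHS]exchange_big -sumrN; apply: eq_bigr => k _; rewrite -sumrN.
by apply: eq_bigr => l _; rewrite wedge_anticomm mon_addC.
Qed.

Lemma ext_diffK (x : E) : ext_diff (ext_diff x) = 0.
Proof.
apply: eq_opp0; rewrite [in RHS]ext_diffE -sumrN [X in ext_diff X = _]ext_diffE linear_sum.
by apply: eq_bigr => k _; rewrite -ext_diff_contract.
Qed.

End CharacteristicZero.

(** * Subspaces spanned by monomials, and acyclicity of the Koszul complex *)

Definition ext_coord (P : pred {set 'I_n}) : {vspace E} := coord_subspace K P.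

Lemma ext_coordP (P : pred {set 'I_n}) (x : E) : reflect (forall S, x S != 0 -> P S)
  (x \in ext_coord P).
Proof. exact: coord_subspaceP. Qed.

(** The span of the x^(t) e_S with P t S. Degree and support conditions all have this shape, so that
    preservation by [kos] and [cokos] becomes a condition on pairs (t, S). *)
Definition form_coord q (P : mon n q -> pred {set 'I_n}) : {vspace form q} :=
  pointwise (fun t => ext_coord (P t)).

Lemma form_coordP q (P : mon n q -> pred {set 'I_n}) (f : form q) :
  reflect (forall t S, f t S != 0 -> P t S) (f \in form_coord P).
Proof.
apply: (iffP (pointwiseP _ _)) => h t; first by move=> S; apply/ext_coordP.
by apply/ext_coordP => S; apply: h.
Qed.

Lemma sum_ext_neq0 (I : finType) (F : I -> E) S : (\sum_i F i) S != 0 ->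
  exists i, F i S != 0.
Proof.
rewrite sum_ffunE => h; apply/existsP; apply: contra_neqT h => /existsPn h.
by apply: big1 => i _; apply/eqP; rewrite -[_ == _]negbK h.
Qed.

Lemma kos_coord q (P : mon n q.+1 -> pred {set 'I_n}) (Q : mon n q -> pred {set 'I_n})
  (f : form q.+1) :
  (forall t k S, P (mon_add k t) S -> k \notin S -> Q t (k |: S)) ->
  f \in form_coord P -> kos f \in form_coord Q.
Proof.
move=> PQ /form_coordP fP; apply/form_coordP => t U; rewrite ffunE => /sum_ext_neq0[k].
rewrite ext_gen_mulE; case: ifP => [kU|]; rewrite ?eqxx // mulf_eq0 negb_or => /andP[_].
by move/fP => /PQ; rewrite setD1K // !inE eqxx => /(_ isT).
Qed.

Lemma pmul_neq0 q k (f : form q) t S : pmul k f t S != 0 ->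
  exists2 s, t = mon_add k s & f s S != 0.
Proof.
have [tk|/mon_addP[s ->]] := eqVneq (expo t k) 0%N.
  by rewrite pmul0 // ffunE eqxx.
rewrite pmul_add ffunE => h; exists s => //.
by apply: contraNneq h => ->; rewrite scaler0.
Qed.

Lemma cokos_coord q (P : mon n q -> pred {set 'I_n}) (Q : mon n q.+1 -> pred {set 'I_n})
  (f : form q) :
  (forall t k S, P t (k |: S) -> k \notin S -> Q (mon_add k t) S) ->
  f \in form_coord P -> cokos f \in form_coord Q.
Proof.
move=> PQ /form_coordP fP; apply/form_coordP => t U; rewrite ffunE => /sum_ext_neq0[k].
rewrite ffunE; case: ifP => [|kU]; rewrite ?eqxx // mulf_eq0 negb_or => /andP[_].
by move/pmul_neq0 => [s -> /fP/PQ]; apply; rewrite kU.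
Qed.

(** Division by the Euler scalar of [kos_cokos]. It commutes with [kos], which lowers q and raises
    #|S| by one. In the single case where the scalar is 0 its inverse is 0. *)
Definition rescale q (f : form q) : form q :=
  [ffun t => [ffun S : {set 'I_n} => (#|S| + q)%:R^-1 * f t S : K^o]].

Lemma rescaleE q (f : form q) t S : rescale f t S = (#|S| + q)%:R^-1 * f t S.
Proof. by rewrite !ffunE. Qed.

Lemma kos_rescale q (f : form q.+1) : kos (rescale f) = rescale (kos f).
Proof.
apply/ffunP => t; apply/ffunP => S; rewrite rescaleE !ffunE !sum_ffunE mulr_sumr.
apply: eq_bigr => k _; rewrite !ext_gen_mulE; case: ifP => kS; last by rewrite mulr0.
by rewrite rescaleE mulrCA [in RHS](cardsD1 k S) kS add1n addnS.
Qed.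

Lemma rescale_coord q (P : mon n q -> pred {set 'I_n}) (f : form q) :
  f \in form_coord P -> rescale f \in form_coord P.
Proof.
move=> /form_coordP fP; apply/form_coordP => t U; rewrite rescaleE mulf_eq0 negb_or.
by case/andP => _ /fP.
Qed.

Section Exactness.
Hypothesis charK : [pchar K] =i pred0.

(** The primitive is [cokos (rescale f)], by Euler's homotopy. P and Q are kept general so that one
    statement serves every grading. *)
Lemma kos_exact q (P : mon n q.+1 -> pred {set 'I_n})
  (Q : mon n q.+2 -> pred {set 'I_n}) (f : form q.+1) :
  (forall t k S, P t (k |: S) -> k \notin S -> Q (mon_add k t) S) ->
  f \in form_coord P -> kos f = 0 -> exists2 g, g \in form_coord Q & f = kos g.
Proof.
move=> PQ fP f0; exists (cokos (rescale f)).
  by apply: cokos_coord PQ _; apply: rescale_coord.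
apply/ffunP => t; apply/ffunP => S; have := kos_cokos (rescale f) t S.
have -> : kos (rescale f) = 0.
  rewrite kos_rescale f0; apply/ffunP => s; apply/ffunP => U.
  by rewrite rescaleE !ffunE mulr0.
rewrite linear0 [(0 : form _) t]ffunE [(0 : E) S]ffunE addr0 => ->.
by rewrite rescaleE mulrA addnS divff ?mul1r // natK_neq0.
Qed.

(** In polynomial degree 0 the only obstruction to exactness is the coefficient of the unit of E. *)
Lemma kos_exact0 (P : mon n 0 -> pred {set 'I_n}) (Q : mon n 1 -> pred {set 'I_n})
  (f : form 0) :
  (forall t k S, P t (k |: S) -> k \notin S -> Q (mon_add k t) S) ->
  f \in form_coord P -> (forall t, f t set0 = 0) ->
  exists2 g, g \in form_coord Q & f = kos g.
Proof.
move=> PQ fP f0; exists (cokos (rescale f)).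
  by apply: cokos_coord PQ _; apply: rescale_coord.
apply/ffunP => t; apply/ffunP => S; rewrite kos_cokos0 rescaleE addn0 mulrA.
have [->|/set0Pn[k kS]] := eqVneq S set0; first by rewrite f0 mulr0.
by rewrite divff ?mul1r // (cardsD1 k S) kS natK_neq0.
Qed.

(** A primitive of f would have exterior degree -1. *)
Lemma kos_inj q (f : form q.+1) :
  f \in form_coord (fun _ S => #|S| == 0%N) -> kos f = 0 -> f = 0.
Proof.
move=> fP f0; have [g0 + ->] : exists2 g, g \in form_coord (fun _ _ => false) & f = kos g.
  by apply: kos_exact fP f0 => t k S; rewrite cardsU1; case: (k \in S).
suff -> : form_coord (fun _ : mon n q.+2 => pred0) = 0%VS.
  by rewrite memv0 => /eqP ->; rewrite linear0.
apply/eqP; rewrite -subv0; apply/subvP => g /form_coordP h; rewrite memv0.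
apply/eqP/ffunP => t; apply/ffunP => S; rewrite !ffunE; apply/eqP.
by apply: contraTT isT => /h.
Qed.

End Exactness.
End KoszulForms.

(** * Koszul complexes of free modules *)

(** The passage from the matrix ranks in [tor_dim] to dimensions of subspaces. *)
Lemma dim_rowspace (K : fieldType) m r (M : 'M[K]_(m, r)) (U : {vspace 'rV[K]_r}) :
  (forall v, (v \in U) = (v <= M)%MS) -> \dim U = \rank M.
Proof.
move=> UM; pose f : 'Hom('rV_(\rank M), 'rV_r) := linfun (mulmxr (row_base M)).
have <- : (f @: fullv = U)%VS.
  apply/vspaceP => v; rewrite UM (_ : (v <= M)%MS = (v <= row_base M)%MS);
    last by rewrite eq_row_base.
  apply/memv_imgP/submxP => [[u _ ->]|[u ->]].
    by exists u; rewrite lfunE.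
  by exists u; rewrite ?memvf // lfunE.
have k0 : (fullv :&: lker f = 0)%VS.
  apply/eqP; rewrite -subv0; apply/subvP => u; rewrite memv_cap memv_ker lfunE /= memv0.
  by move=> /andP[_]; rewrite mulmx_free_eq0 ?row_base_free.
by rewrite limg_dim_eq // dimvf /dim /= mul1n.
Qed.

Section MatrixForms.
Variables (K : fieldType) (n : nat).
Hypothesis charK : [pchar K] =i pred0.
Local Notation E := (exterior K n).
Local Notation form q := {ffun mon n q -> E}.
Local Notation mform r q := {ffun 'I_r -> form q}.

Definition mkos r q (f : mform r q.+1) : mform r q := [ffun a => kos (f a)].

Fact mkos_is_linear r q : linear (@mkos r q).
Proof. by move=> c f g; apply/ffunP => a; rewrite !ffunE linearP. Qed.
HB.instance Definition _ r q :=
  GRing.isLinear.Build K (mform r q.+1) (mform r q) *:%R (@mkos r q) (@mkos_is_linear r q).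

Lemma memv_mkos r q (f : mform r q.+1) (U : {vspace mform r q.+1}) :
  f \in U -> mkos f \in (linfun (@mkos r q) @: U)%VS.
Proof. exact: memv_linfun_img. Qed.

Definition mform_mulmx r s (M : 'M[E]_(r, s)) q (f : mform r q) : mform s q :=
  [ffun b => [ffun t => \sum_a f a t * M a b]].

Fact mform_mulmx_is_linear r s M q : linear (@mform_mulmx r s M q).
Proof.
move=> c f g; apply/ffunP => b; apply/ffunP => t; rewrite !ffunE scaler_sumr -big_split.
by apply: eq_bigr => a _; rewrite !ffunE mulrDl scalerAl.
Qed.
HB.instance Definition _ r s M q :=
  GRing.isLinear.Build K (mform r q) (mform s q) *:%R (@mform_mulmx r s M q)
    (@mform_mulmx_is_linear r s M q).

(** Associativity: matrices multiply coefficients on the right, the Koszul differential on the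
    left. *)
Lemma mkos_mulmx r s (M : 'M[E]_(r, s)) q (f : mform r q.+1) :
  mkos (mform_mulmx M f) = mform_mulmx M (mkos f).
Proof.
apply/ffunP => b; apply/ffunP => t; rewrite !ffunE.
under [RHS]eq_bigr => a _ do rewrite !ffunE mulr_suml.
rewrite exchange_big; apply: eq_bigr => k _; rewrite !ffunE mulr_sumr.
by apply: eq_bigr => a _; rewrite mulrA.
Qed.

Lemma mkos_mkos r q (f : mform r q.+2) : mkos (mkos f) = 0.
Proof. by apply/ffunP => a; rewrite !ffunE kos_kos. Qed.

Variable j : nat.

(** Internal degree j: e_S counts for #|S|, a monomial for its degree q, and the basis vector of the
    free module for d. *)
Definition homog_form q d : {vspace form q} :=
  form_coord K (fun _ S => #|S| + q + d == j)%N.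

Definition homog_mform r (deg : 'I_r -> nat) q : {vspace mform r q} :=
  pointwise (fun a => homog_form q (deg a)).

Lemma kos_homog q d f : f \in homog_form q.+1 d -> kos f \in homog_form q d.
Proof.
by apply: kos_coord => t k S /= /eqP <- kS; rewrite cardsU1 kS add1n addnS.
Qed.

Lemma mkos_homog r (deg : 'I_r -> nat) q f :
  f \in homog_mform deg q.+1 -> mkos f \in homog_mform deg q.
Proof.
by move=> /pointwiseP fj; apply/pointwiseP => a; rewrite ffunE kos_homog.
Qed.

Lemma homog_step q d (k : 'I_n) (S : {set 'I_n}) :
  (#|k |: S| + q + d == j -> k \notin S -> #|S| + q.+1 + d == j)%N.
Proof. by move=> /eqP <- kS; rewrite cardsU1 kS add1n addnS. Qed.

Lemma kos_homog_exact q d f : f \in homog_form q.+1 d -> kos f = 0 ->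
  exists2 g, g \in homog_form q.+2 d & f = kos g.
Proof. by apply: kos_exact => // t k S; apply: homog_step. Qed.

Lemma mkos_exact r (deg : 'I_r -> nat) q f :
  f \in homog_mform deg q.+1 -> mkos f = 0 ->
  exists2 g, g \in homog_mform deg q.+2 & f = mkos g.
Proof.
move=> /pointwiseP fj f0.
have /fin_all_exists2[g gj fg] a : exists2 g, g \in homog_form q.+2 (deg a) & f a = kos g.
  by apply: kos_homog_exact => //; have /ffunP/(_ a) := f0; rewrite !ffunE.
exists (finfun g); first by apply/pointwiseP => a; rewrite ffunE.
by apply/ffunP => a; rewrite !ffunE.
Qed.

Lemma mkos_exact0 r (deg : 'I_r -> nat) f :
  f \in homog_mform deg 0 -> (forall a t, f a t set0 = 0) ->
  exists2 g, g \in homog_mform deg 1 & f = mkos g.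
Proof.
move=> /pointwiseP fj f0.
have /fin_all_exists2[g gj fg] a : exists2 g, g \in homog_form 1 (deg a) & f a = kos g.
  by apply: (kos_exact0 charK _ (fj a)) => // t k S; apply: homog_step.
exists (finfun g); first by apply/pointwiseP => a; rewrite ffunE.
by apply/ffunP => a; rewrite !ffunE.
Qed.

Definition truncate q d (x : E) : E :=
  [ffun S : {set 'I_n} => if (#|S| + q + d == j)%N then x S else 0].

Fact truncate_is_linear q d : linear (truncate q d).
Proof.
move=> c x y; apply/ffunP => S; rewrite !ffunE; case: ifP => // _.
by rewrite scaler0 addr0.
Qed.
HB.instance Definition _ q d :=
  GRing.isLinear.Build K E E *:%R (truncate q d) (truncate_is_linear q d).

Lemma truncate_coord q d x : truncate q d x \in ext_coord K (fun S => #|S| + q + d == j)%N.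
Proof. by apply/ext_coordP => S; rewrite ffunE; case: ifP => //; rewrite eqxx. Qed.

Lemma truncate_id q d x : x \in ext_coord K (fun S => #|S| + q + d == j)%N -> truncate q d x = x.
Proof.
move/ext_coordP => xj; apply/ffunP => S; rewrite ffunE; case: ifP => // /negP h.
by apply/esym/eqP; apply: contraT => /xj/h.
Qed.

Lemma truncate_mul q c d (x y : E) : (forall S, y S != 0 -> (#|S| + c)%N = d) ->
  truncate q d x * y = truncate q c (x * y).
Proof.
move=> hy; apply/ffunP => U; rewrite ![in RHS]ffunE.
rewrite [LHS]ffunE.
transitivity (\sum_(S : {set 'I_n} | S \subset U)
  if (#|U| + q + c == j)%N then (-1) ^+ ninv S (U :\: S) * x S * y (U :\: S) else 0).
  apply: eq_bigr => S SU; have [->|/hy e] := eqVneq (y (U :\: S)) 0.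
    by rewrite !mulr0 if_same.
  have := cardsID S U; rewrite (setIidPr SU) => eU.
  rewrite ffunE (_ : (#|S| + q + d == j) = (#|U| + q + c == j))%N;
    last by congr (_ == _); lia.
  by case: ifP; rewrite ?(mulr0, mul0r).
by case: ifP => // _; rewrite big1.
Qed.

(** Lifts are chosen coefficient by coefficient and then cut down to the right degree. The cut
    commutes with M because the entries of M are homogeneous ([truncate_mul]). *)
Lemma homog_lift r s (degr : 'I_r -> nat) (degs : 'I_s -> nat) (M : 'M[E]_(r, s)) q f :
  (forall a b S, M a b S != 0 -> (#|S| + degs b)%N = degr a) ->
  f \in homog_mform degs q ->
  (forall t, exists w, \row_b f b t = w *m M) ->
  exists2 g, g \in homog_mform degr q & f = mform_mulmx M g.
Proof.
move=> Mj /pointwiseP fj /fin_all_exists[w fw].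
exists [ffun a => [ffun t => truncate q (degr a) (w t 0 a)]].
  apply/pointwiseP => a; apply/pointwiseP => t; rewrite !ffunE; exact: truncate_coord.
apply/ffunP => b; apply/ffunP => t; rewrite !ffunE.
have /pointwiseP/(_ t)/truncate_id <- := fj b.
have := congr1 (fun v : 'rV_s => v 0 b) (fw t); rewrite !mxE => ->.
rewrite linear_sum; apply: eq_bigr => a _; rewrite !ffunE.
by rewrite (truncate_mul _ _ (Mj a b)).
Qed.

Lemma mulmx_homog r s (degr : 'I_r -> nat) (degs : 'I_s -> nat) (M : 'M[E]_(r, s)) q f :
  (forall a b S, M a b S != 0 -> (#|S| + degs b)%N = degr a) ->
  f \in homog_mform degr q -> mform_mulmx M f \in homog_mform degs q.
Proof.
move=> Mj /pointwiseP fj; apply/pointwiseP => b; apply/pointwiseP => t; rewrite !ffunE.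
apply: memv_suml => a _; have /pointwiseP/(_ t)/truncate_id <- := fj a.
by rewrite (truncate_mul _ _ (Mj a b)) truncate_coord.
Qed.

Section Shift.
Variables (r : nat) (deg : 'I_r -> nat).
Variable Z : forall q, {vspace mform r q}.
Local Notation X q := (homog_mform deg q).
Local Notation d := (linfun (@mkos r _)).

(* For Z given by a submodule Z' of a free module F, [coker_homology] is the Koszul
   homology of F/Z' in polynomial degree q + 1, and [sub_homology] is that of Z' in
   degree q, except that for q = 0 it is that of (Z' :&: mF)/mZ'. *)
Definition coker_homology q :=
  (\dim (X q.+1 :&: d @^-1: Z q) - \dim (Z q.+1 + d @: X q.+2))%N.

Definition sub_homology q :=
  (\dim (Z q :&: d @: X q.+1) - \dim (d @: Z q.+1))%N.

Hypothesis ZX : forall q, (Z q <= X q)%VS.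
Hypothesis kosZ : forall q f, f \in Z q.+1 -> mkos f \in Z q.

(** The connecting map of 0 -> Z' -> F -> F/Z' -> 0 is induced by the Koszul differential itself; it
    is bijective since the Koszul complex of F is exact in positive polynomial degree. *)
Lemma coker_homologyE q : coker_homology q = sub_homology q.
Proof.
have U21 : (Z q.+1 + d @: X q.+2 <= X q.+1 :&: d @^-1: Z q)%VS.
  rewrite subv_add; apply/andP; split; apply/subvP => f.
    by move=> fZ; rewrite memv_cap (subvP (ZX _)) // -memv_preim lfunE kosZ.
  case/memv_imgP => g gX ->; rewrite memv_cap lfunE mkos_homog //.
  by rewrite -memv_preim !lfunE /= mkos_mkos mem0v.
rewrite /coker_homology (dim_subquotient_img U21 (f := d)).
  rewrite /sub_homology; congr (_ - _)%N; congr (\dim _); apply/vspaceP => f.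
    apply/memv_imgP/idP => [[g + ->]|].
      by rewrite !memv_cap -memv_preim => /andP[gX ->]; rewrite memv_img.
    rewrite memv_cap => /andP[+ /memv_imgP[g gX fE]] => fZ.
    by exists g => //; rewrite memv_cap gX -memv_preim -fE.
  apply/memv_imgP/memv_imgP => [[g /memv_addP[z zZ [x /memv_imgP[y _ ->] ->]] ->]|[g gZ ->]].
    by exists z => //; rewrite linearD /= !lfunE /= mkos_mkos addr0.
  by exists g => //; rewrite (subvP (addvSl _ _)).
apply/subvP => f; rewrite !memv_cap memv_ker lfunE => /andP[/andP[fX _] /eqP f0].
have [g gX ->] := mkos_exact fX f0.
by apply: (subvP (addvSr _ _)); exact: memv_mkos.
Qed.

End Shift.

Section KernelShift.
Variables (r s : nat) (degr : 'I_r -> nat) (degs : 'I_s -> nat) (M : 'M[E]_(r, s)).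
Hypothesis Mj : (forall a b S, M a b S != 0 -> (#|S| + degs b)%N = degr a).
Local Notation X q := (homog_mform degr q).
Local Notation phi := (linfun (@mform_mulmx r s M _)).
Local Notation d := (linfun (@mkos _ _)).

Definition mx_kernel q : {vspace mform r q} := (X q :&: lker (linfun (@mform_mulmx r s M q)))%VS.

Lemma mx_kernelS q : (mx_kernel q <= X q)%VS.
Proof. exact: capvSl. Qed.

Lemma kos_mx_kernel q f : f \in mx_kernel q.+1 -> mkos f \in mx_kernel q.
Proof.
rewrite !memv_cap !memv_ker !lfunE /= => /andP[fX /eqP f0].
by rewrite mkos_homog // -mkos_mulmx f0 linear0 eqxx.
Qed.

Variable Z : forall q, {vspace mform s q}.
Hypothesis ZE : forall q, Z q = (phi @: X q)%VS.

(** Multiplication by M identifies F/ker M with its image Z. The Koszul homology of the quotient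
    thus becomes that of a submodule of the next free module. *)
Lemma coker_homology_kernel q :
  coker_homology degr mx_kernel q = sub_homology degs Z q.+1.
Proof.
have U21 : (mx_kernel q.+1 + d @: X q.+2 <= X q.+1 :&: d @^-1: mx_kernel q)%VS.
  rewrite subv_add; apply/andP; split; apply/subvP => f.
    by move=> fZ; rewrite memv_cap (subvP (mx_kernelS _)) // -memv_preim lfunE kos_mx_kernel.
  case/memv_imgP => g gX ->; rewrite memv_cap lfunE mkos_homog //.
  by rewrite -memv_preim !lfunE /= mkos_mkos mem0v.
rewrite /coker_homology (dim_subquotient_img U21 (f := phi)).
  rewrite /sub_homology; congr (_ - _)%N; congr (\dim _); apply/vspaceP => f.
    apply/memv_imgP/idP => [[g + ->]|].
      rewrite !memv_cap -memv_preim memv_cap memv_ker !lfunE /= => /and3P[gX _ /eqP g0].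
      apply/andP; split.
        by rewrite ZE; exact: memv_linfun_img.
      have [] := @mkos_exact s degs q (mform_mulmx M g).
      - exact: mulmx_homog gX.
      - by rewrite mkos_mulmx.
      by move=> h hX ->; exact: memv_mkos.
    rewrite memv_cap ZE => /andP[/memv_imgP[g gX ->] /memv_imgP[h hX e]].
    exists g => //; rewrite memv_cap gX -memv_preim memv_cap !lfunE /= mkos_homog //.
    by rewrite memv_ker lfunE /= -mkos_mulmx; move: e; rewrite !lfunE /= => ->;
      rewrite mkos_mkos.
  rewrite ZE; apply/memv_imgP/memv_imgP.
    move=> [g /memv_addP[z zZ [x /memv_imgP[y yX ->] ->]] ->].
    exists (phi y); rewrite ?memv_img // linearD /= !lfunE /= mkos_mulmx.
    by move: zZ; rewrite memv_cap memv_ker lfunE /= => /andP[_ /eqP ->]; rewrite add0r.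
  move=> [_ /memv_imgP[g gX ->] ->]; exists (d g); last by rewrite !lfunE /= mkos_mulmx.
  by rewrite (subvP (addvSr _ _)) ?memv_img.
apply/subvP => f; rewrite memv_cap => /andP[fU fk]; rewrite (subvP (addvSl _ _)) //.
by move: fU; rewrite !memv_cap => /andP[-> _].
Qed.

End KernelShift.
End MatrixForms.

(** * Dimension shifting along a free resolution *)

Section TorKoszul.
Variables (K : fieldType) (n : nat).
Hypothesis charK : [pchar K] =i pred0.
Local Notation E := (exterior K n).
Local Notation form q := {ffun mon n q -> E}.
Local Notation mform r q := {ffun 'I_r -> form q}.
Variables (I : {vspace E}) (P : free_resolution I) (j : nat).
Hypothesis I_left : forall x y, y \in I -> x * y \in I.
Hypothesis I_graded : forall d y, y \in I -> ext_comp d y \in I.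

Local Notation rk := (res_rank P).
Local Notation dg k := (@res_deg _ _ _ P k).
Local Notation M := (res_diff P).
Local Notation XF k q := (@homog_mform K n j (rk k) (dg k) q).
Local Notation XE q := (@homog_form K n j q 0).
Local Notation d := (linfun (@mkos K n _ _)).
Local Notation kd := (linfun (@kos K n _)).

Definition ideal_forms q : {vspace form q} := (XE q :&: pointwise (fun=> I))%VS.

(** Koszul homology of E/I in polynomial degree q + 1 and internal degree j, written on
    representatives in E. *)
Definition ideal_homology q : nat :=
  (\dim (XE q.+1 :&: kd @^-1: ideal_forms q) - \dim (ideal_forms q.+1 + kd @: XE q.+2))%N.

Definition aug_form q (f : mform (rk 0) q) : form q := mform_mulmx (res_aug P) f 0.

Fact aug_form_is_linear q : linear (@aug_form q).
Proof. by move=> c f g; rewrite /aug_form linearP !ffunE. Qed.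
HB.instance Definition _ q := GRing.isLinear.Build K (mform (rk 0) q) (form q) *:%R
  (@aug_form q) (@aug_form_is_linear q).

Local Notation aug := (linfun (@aug_form _)).

Definition aug_kernel q : {vspace mform (rk 0) q} :=
  (XF 0 q :&: aug @^-1: pointwise (fun=> I))%VS.

Lemma aug_form_homog q f : f \in XF 0 q -> aug_form f \in XE q.
Proof.
move=> fX; have /pointwiseP/(_ 0) // : mform_mulmx (res_aug P) f \in homog_mform K n j (fun=> 0%N) q.
by apply: mulmx_homog fX => a b S; rewrite ord1 addn0; exact: res_aug_homog.
Qed.

Lemma kos_aug_form q f : kos (@aug_form q.+1 f) = aug_form (mkos f).
Proof. by rewrite /aug_form -mkos_mulmx [RHS]ffunE. Qed.

Lemma kos_ideal_forms q f : f \in ideal_forms q.+1 -> kos f \in ideal_forms q.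
Proof.
rewrite !memv_cap => /andP[fX /pointwiseP fI]; rewrite kos_homog //=.
apply/pointwiseP => t; rewrite ffunE; apply: memv_suml => k _; exact: I_left.
Qed.

Lemma kos_aug_kernel q f : f \in aug_kernel q.+1 -> mkos f \in aug_kernel q.
Proof.
rewrite !memv_cap -!memv_preim !lfunE /= => /andP[fX fI]; rewrite mkos_homog //=.
rewrite -kos_aug_form; have : aug_form f \in ideal_forms q.+1.
  by rewrite memv_cap aug_form_homog.
by move/kos_ideal_forms; rewrite memv_cap => /andP[].
Qed.

(** Forms with values in the kernel of F_k -> F_(k-1), or of F_0 -> E/I when k = 0. *)
Definition kernel_form k : forall q, {vspace mform (rk k) q} :=
  match k with
  | 0 => aug_kernel
  | k'.+1 => mx_kernel j (dg k'.+1) (M k')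
  end.

Lemma kernel_formS k q : (kernel_form k q <= XF k q)%VS.
Proof. by case: k => [|k]; exact: capvSl. Qed.

Lemma kos_kernel_form k q f : f \in kernel_form k q.+1 -> mkos f \in kernel_form k q.
Proof. by case: k f => [|k] f; [exact: kos_aug_kernel | exact: kos_mx_kernel]. Qed.

Lemma row_mform_mulmx r s (N : 'M[E]_(r, s)) q (f : mform r q) t :
  \row_b mform_mulmx N f b t = (\row_a f a t) *m N.
Proof. by apply/rowP => b; rewrite !mxE !ffunE; apply: eq_bigr => a _; rewrite mxE. Qed.

Lemma kernel_form_row k q f : f \in XF k q ->
  reflect (forall t, exists w, \row_b f b t = w *m M k) (f \in kernel_form k q).
Proof.
case: k f => [|k] f fX; rewrite /= memv_cap fX /=; apply: (iffP idP).
- rewrite -memv_preim lfunE => /pointwiseP h t; apply/res_exact0.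
  by rewrite -row_mform_mulmx mxE; exact: h.
- move=> h; rewrite -memv_preim lfunE; apply/pointwiseP => t.
  by have /res_exact0 := h t; rewrite -row_mform_mulmx mxE.
- rewrite memv_ker lfunE /= => /eqP f0 t; apply/res_exact; rewrite -row_mform_mulmx f0.
  by apply/rowP => b; rewrite !mxE !ffunE.
move=> h; rewrite memv_ker lfunE /=; apply/eqP/ffunP => b; apply/ffunP => t.
have /res_exact := h t; rewrite -row_mform_mulmx => /rowP /(_ b).
by rewrite !mxE !ffunE.
Qed.

(** Exactness of the resolution, applied to each coefficient and made homogeneous by
    [homog_lift]. *)
Lemma kernel_form_img k q :
  kernel_form k q = (linfun (@mform_mulmx _ _ _ _ (M k) q) @: XF k.+1 q)%VS.
Proof.
have Mj := @res_diff_homog _ _ _ P k.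
apply/vspaceP => f; apply/idP/memv_imgP => [fZ|[g gX ->]].
  have fX := subvP (kernel_formS k q) _ fZ.
  have /(homog_lift Mj fX)[g gX ->] := kernel_form_row fX fZ.
  by exists g => //; rewrite lfunE.
rewrite lfunE /=; apply/kernel_form_row; first exact: mulmx_homog gX.
by move=> t; rewrite row_mform_mulmx; exists (\row_a g a t).
Qed.

(** With Z_k the kernel in F_k, the connecting map for Z_(k+1) inside F_(k+1) and the isomorphism of
    F_(k+1)/Z_(k+1) with Z_k together trade one homological step for one polynomial degree. *)
Lemma sub_homology_kernel_form k q :
  sub_homology j (dg k.+1) (kernel_form k.+1) q = sub_homology j (dg k) (kernel_form k) q.+1.
Proof.
rewrite -(coker_homologyE charK (@kernel_formS k.+1) (@kos_kernel_form k.+1)).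
exact: (coker_homology_kernel charK (@res_diff_homog _ _ _ P k) (kernel_form_img k)).
Qed.

Lemma sub_homology_kernel_form0 k q :
  sub_homology j (dg k) (kernel_form k) q = sub_homology j (dg 0) (kernel_form 0) (k + q).
Proof.
elim: k q => [|k IHk] q; first by [].
by rewrite sub_homology_kernel_form IHk addnS.
Qed.

(** A lift along F_0 -> E/I of each coefficient, truncated to its homogeneous part; the error stays
    in I because I is graded. *)
Lemma aug_form_surj q x : x \in XE q ->
  exists2 f, f \in XF 0 q & x - aug_form f \in ideal_forms q.
Proof.
move=> xX; have /fin_all_exists[w xw] t := res_aug_surj P (x t).
pose f : mform (rk 0) q := [ffun a => [ffun t => truncate j q (dg 0 a) (w t 0 a)]].
have fX : f \in XF 0 q.
  by apply/pointwiseP => a; apply/pointwiseP => t; rewrite !ffunE truncate_coord.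
exists f => //; rewrite memv_cap rpredB ?aug_form_homog //=; apply/pointwiseP => t.
have -> : (x - aug_form f) t = truncate j q 0 (x t - (w t *m res_aug P) 0 0).
  rewrite linearB /= truncate_id; last by have /pointwiseP := xX; apply.
  rewrite ffunE [X in _ + X]ffunE; congr (_ - _);
    rewrite mxE linear_sum /aug_form !ffunE; apply: eq_bigr => a _.
  rewrite !ffunE (@truncate_mul _ _ _ _ 0) // => S; rewrite addn0; exact: res_aug_homog.
have [le_qj|lt_jq] := leqP q j.
  have -> y : truncate j q 0 y = ext_comp (j - q) y; last exact: I_graded.
  apply/ffunP => S; rewrite !ffunE addn0 (_ : _ == j = (#|S| == j - q)%N) //.
  by apply/eqP/eqP; lia.
rewrite (_ : truncate _ _ _ _ = 0) ?mem0v //; apply/ffunP => S; rewrite !ffunE.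
by rewrite ifF //; apply/eqP; lia.
Qed.

Lemma ideal_homologyE q : coker_homology j (dg 0) aug_kernel q = ideal_homology q.
Proof.
(* [rho] plays the quotient map by the I-valued forms; both subquotients are pushed forward along it
   and compared there. *)
have [rho rhoK] := lker_exists (ideal_forms q.+1).
have rho0 f : f \in ideal_forms q.+1 -> rho f = 0 by rewrite -rhoK memv_ker => /eqP.
have UE21 : (ideal_forms q.+1 + kd @: XE q.+2 <= XE q.+1 :&: kd @^-1: ideal_forms q)%VS.
  rewrite subv_add; apply/andP; split; apply/subvP => f.
    move=> fI; rewrite memv_cap -memv_preim lfunE kos_ideal_forms // andbT.
    by move: fI; rewrite memv_cap => /andP[].
  case/memv_imgP => g gX ->; rewrite memv_cap lfunE kos_homog //.
  by rewrite -memv_preim !lfunE /= kos_kos // mem0v.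
have U21 : (aug_kernel q.+1 + d @: XF 0 q.+2 <= XF 0 q.+1 :&: d @^-1: aug_kernel q)%VS.
  rewrite subv_add; apply/andP; split; apply/subvP => f.
    move=> fZ; rewrite memv_cap -memv_preim lfunE kos_aug_kernel // andbT.
    by move: fZ; rewrite memv_cap => /andP[].
  case/memv_imgP => g gX ->; rewrite memv_cap lfunE mkos_homog //.
  by rewrite -memv_preim !lfunE /= mkos_mkos // mem0v.
rewrite /coker_homology /ideal_homology.
rewrite (dim_subquotient_img UE21 (f := rho)); last first.
  by rewrite rhoK; apply: subv_trans (capvSr _ _) (addvSl _ _).
rewrite (dim_subquotient_img U21 (f := (rho \o aug)%VF)); last first.
  apply/subvP => f; rewrite !memv_cap memv_ker comp_lfunE => /andP[/andP[fX _]].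
  rewrite -memv_ker rhoK lfunE memv_cap /= => /andP[_ fI].
  by rewrite (subvP (addvSl _ _)) // memv_cap fX -memv_preim lfunE.
have lift x : x \in XE q.+1 -> exists2 f, f \in XF 0 q.+1 & rho x = rho (aug f) /\ x - aug_form f \in ideal_forms q.+1.
  move=> /aug_form_surj[f fX fI]; exists f => //; split=> //.
  by apply/eqP; rewrite -subr_eq0 -linearB lfunE; apply/eqP/rho0.
congr (_ - _)%N; congr (\dim _); apply/vspaceP => y; apply/memv_imgP/memv_imgP.
- move=> [f + ->]; rewrite memv_cap -memv_preim memv_cap lfunE => /andP[fX].
  rewrite -memv_preim !lfunE /= -kos_aug_form => /andP[_ fI].
  exists (aug_form f); last by rewrite ?comp_lfunE /= ?lfunE.
  rewrite memv_cap aug_form_homog //= -memv_preim memv_cap !lfunE fI.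
  by rewrite kos_homog ?aug_form_homog.
- move=> [x + ->]; rewrite memv_cap -memv_preim lfunE => /andP[xX xI].
  have [f fX [-> fI]] := lift x xX; exists f; last by rewrite comp_lfunE.
  rewrite memv_cap fX -memv_preim memv_cap lfunE mkos_homog //= -memv_preim lfunE /=.
  rewrite -kos_aug_form; move/kos_ideal_forms: fI; rewrite linearB /= => fI.
  have := rpredB xI fI; rewrite opprB addrCA subrr addr0 memv_cap.
  by case/andP.
- move=> [f /memv_addP[z zZ [_ /memv_imgP[x xX ->] ->]] ->].
  exists (kd (aug_form x)).
    by rewrite (subvP (addvSr _ _)) // memv_img // aug_form_homog.
  rewrite comp_lfunE !lfunE /= linearD /= kos_aug_form linearD /= rho0 ?add0r //.
  by rewrite memv_cap aug_form_homog; move: zZ;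
    rewrite memv_cap -memv_preim lfunE => /andP[].
move=> [f /memv_addP[z zI [_ /memv_imgP[x xX ->] ->]] ->].
have [g gX gI] := aug_form_surj xX; exists (d g).
  by rewrite (subvP (addvSr _ _)) // memv_img.
rewrite comp_lfunE !lfunE /= -kos_aug_form linearD /= rho0 // add0r; apply/eqP.
by rewrite -subr_eq0 -!linearB /=; apply/eqP/rho0/kos_ideal_forms.
Qed.

End TorKoszul.

(** * Tor as Koszul homology *)

Section TorDim.
Variables (K : fieldType) (n : nat).
Hypothesis charK : [pchar K] =i pred0.
Local Notation E := (exterior K n).
Local Notation form q := {ffun mon n q -> E}.
Local Notation mform r q := {ffun 'I_r -> form q}.
Variables (I : {vspace E}) (P : free_resolution I) (j : nat).
Hypothesis I_left : forall x y, y \in I -> x * y \in I.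
Hypothesis I_graded : forall d y, y \in I -> ext_comp d y \in I.

Local Notation rk := (res_rank P).
Local Notation dg k := (@res_deg _ _ _ P k).
Local Notation M := (res_diff P).
Local Notation XF k q := (@homog_mform K n j (rk k) (dg k) q).
Local Notation d := (linfun (@mkos K n _ _)).
Local Notation phi k := (linfun (@mform_mulmx K n _ _ (M k) 0)).
Local Notation t0 := (mon0 n).

Definition mform_aug r (f : mform r 0) : 'rV[K]_r := \row_a ext_aug (f a t0).

Fact mform_aug_is_linear r : linear (@mform_aug r).
Proof. by move=> c f g; apply/rowP => a; rewrite !mxE !ffunE /ext_aug !ffunE. Qed.
HB.instance Definition _ r := GRing.isLinear.Build K (mform r 0) 'rV[K]_r *:%R
  (@mform_aug r) (@mform_aug_is_linear r).
Local Notation aug := (linfun (@mform_aug _)).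

Lemma mform_aug_mkos r (f : mform r 1) : mform_aug (mkos f) = 0.
Proof.
apply/rowP => a; rewrite !mxE !ffunE raddf_sum big1 // => k _.
by rewrite /= /ext_aug ext_gen_mulE inE.
Qed.

Lemma mform_aug_mulmx r s (N : 'M[E]_(r, s)) f :
  mform_aug (mform_mulmx N f) = mform_aug f *m map_mx (@ext_aug K n) N.
Proof.
apply/rowP => b; rewrite !mxE !ffunE raddf_sum; apply: eq_bigr => a _.
by rewrite !mxE /= rmorphM.
Qed.

(** The kernel of reduction modulo the augmentation ideal m is mF, which is the image of the Koszul
    differential from polynomial degree 1. *)
Lemma mform_aug_eq0 k f : f \in XF k 0 -> mform_aug f = 0 ->
  exists2 g, g \in XF k 1 & f = mkos g.
Proof.
move=> fX /rowP f0; apply: mkos_exact0 => // a t.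
by rewrite (mon0_all_equal t t0); have := f0 a; rewrite !mxE.
Qed.

Lemma tor_degree_partP k (v : 'rV[K]_(rk k)) :
  reflect (exists2 f, f \in XF k 0 & v = mform_aug f) (v <= tor_degree_part P k j)%MS.
Proof.
apply: (iffP submxP) => [[u ->]|[f /pointwiseP fX ->]].
  exists [ffun a => [ffun=> (u 0 a * (dg k a == j)%:R) *: 1]].
    apply/pointwiseP => a; rewrite ffunE; apply/form_coordP => t S.
    rewrite !ffunE; have [->|_] := eqVneq S set0; last by rewrite scaler0 eqxx.
    rewrite cards0 !add0n; have [//|_] := eqVneq (dg k a) j.
    by rewrite mulr0 scale0r eqxx.
  apply/rowP => a; rewrite mul_mx_diag !mxE !ffunE /ext_aug ffunE.
  by rewrite ffunE eqxx /GRing.scale /= mulr1.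
exists (mform_aug f); apply/rowP => a; rewrite mul_mx_diag !mxE.
have [_|ja] := eqVneq (dg k a) j; first by rewrite mulr1.
rewrite mulr0; apply/eqP/contraT => h; have /form_coordP/(_ t0 set0 h) := fX a.
by rewrite cards0 !add0n (negPf ja).
Qed.

Lemma tor_dim_sub_homology k :
  tor_dim P k.+1 j = sub_homology j (dg k) (kernel_form P j k) 0.
Proof.
(* Tor_(k+1) and (Z_k :&: mF_k)/mZ_k are both images of U1/U2, where U1 consists of the elements of
   F_(k+1) mapped into mF_k and U2 = Z_(k+1) + mF_(k+1). The augmentation gives the first, the
   differential the second. *)
pose U1 := (XF k.+1 0 :&: phi k @^-1: (d @: XF k 1))%VS.
pose U2 := (kernel_form P j k.+1 0 + d @: XF k.+1 1)%VS.
have Mj k' := @res_diff_homog _ _ _ P k'.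
have U21 : (U2 <= U1)%VS.
  rewrite subv_add; apply/andP; split; apply/subvP => f.
    rewrite memv_cap => /andP[fX]; rewrite memv_ker => /eqP f0.
    by rewrite memv_cap fX -memv_preim f0 mem0v.
  case/memv_imgP => g gX ->; rewrite memv_cap lfunE mkos_homog //.
  rewrite -memv_preim lfunE /= -mkos_mulmx; apply: memv_mkos.
  exact: mulmx_homog (Mj k) gX.
transitivity (\dim U1 - \dim U2)%N; last first.
  rewrite (dim_subquotient_img U21 (f := phi k)); last first.
    apply/subvP => f; rewrite memv_cap => /andP[fU fk]; rewrite (subvP (addvSl _ _)) //.
    by move: fU; rewrite !memv_cap fk => /andP[-> _].
  rewrite /sub_homology !kernel_form_img //.
  congr (_ - _)%N; congr (\dim _); apply/vspaceP => y.
    apply/memv_imgP/idP => [[f + ->]|].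
      rewrite !memv_cap -memv_preim => /andP[fX ->]; rewrite andbT memv_img //.
    rewrite memv_cap => /andP[/memv_imgP[f fX ->] h]; exists f => //.
    by rewrite memv_cap fX -memv_preim.
  apply/memv_imgP/memv_imgP.
    move=> [f /memv_addP[z + [_ /memv_imgP[g gX ->] ->]] ->].
    rewrite memv_cap memv_ker => /andP[_ /eqP z0]; rewrite linearD /= z0 add0r.
    exists (linfun (@mform_mulmx K n _ _ (M k) 1) g); rewrite ?memv_img //.
    by rewrite !lfunE /= mkos_mulmx.
  move=> [_ /memv_imgP[g gX ->] ->]; exists (d g); last by rewrite !lfunE /= mkos_mulmx.
  by rewrite (subvP (addvSr _ _)) // memv_img.
rewrite (dim_subquotient_img U21 (f := aug)); last first.
  apply/subvP => f; rewrite !memv_cap memv_ker lfunE /= => /andP[/andP[fX _] /eqP f0].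
  have [g gX ->] := mform_aug_eq0 fX f0.
  by apply: (subvP (addvSr _ _)); exact: memv_mkos.
rewrite /tor_dim; congr (_ - _)%N; apply/esym/dim_rowspace => v; apply/memv_imgP/idP.
- move=> [f + ->]; rewrite memv_cap -memv_preim lfunE /= => /andP[fX /memv_imgP[g gX e]].
  rewrite sub_capmx; apply/andP; split.
    by rewrite lfunE; apply/tor_degree_partP; exists f.
  by apply/sub_kermxP; rewrite lfunE -mform_aug_mulmx e lfunE mform_aug_mkos.
- rewrite sub_capmx => /andP[/tor_degree_partP[f fX ->]] /sub_kermxP f0.
  exists f; rewrite ?lfunE // memv_cap fX -memv_preim lfunE /=.
  have [||g gX ->] := @mform_aug_eq0 k (mform_mulmx (M k) f).
  + exact: mulmx_homog (Mj k) fX.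
  + by rewrite mform_aug_mulmx.
  exact: memv_mkos.
- move=> [f /memv_addP[z + [_ /memv_imgP[g gX ->] ->]] ->].
  rewrite kernel_form_img // => /memv_imgP[h hX ->];
    rewrite !lfunE linearD /= mform_aug_mkos addr0.
  by rewrite mform_aug_mulmx submxMr //; apply/tor_degree_partP; exists h.
case/submxP => u ->; rewrite mulmxA.
have /tor_degree_partP[h hX ->] : (u *m tor_degree_part P k.+2 j <= tor_degree_part P k.+2 j)%MS.
  exact: submxMl.
exists (phi k.+1 h); last by rewrite !lfunE /= mform_aug_mulmx.
by rewrite (subvP (addvSl _ _)) // kernel_form_img // memv_img.
Qed.

Theorem tor_dim_ideal_homology q : tor_dim P q.+1 j = ideal_homology I j q.
Proof.
rewrite tor_dim_sub_homology sub_homology_kernel_form0 // addn0.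
rewrite -coker_homologyE // ?ideal_homologyE //.
- exact: kernel_formS.
- exact: kos_kernel_form.
Qed.

End TorDim.

(** * The local strands *)

Section LocalForms.
Variables (K : fieldType) (n : nat).
Hypothesis charK : [pchar K] =i pred0.
Local Notation E := (exterior K n).
Local Notation form q := {ffun mon n q -> E}.
Implicit Types (k l : 'I_n) (S U X : {set 'I_n}).

Definition ext_on X p : {vspace E} := ext_coord K (fun S => (S \subset X) && (#|S| == p)).

Lemma dim_ext_on X p : \dim (ext_on X p) = 'C(#|X|, p).
Proof.
rewrite -cards_draws /ext_on /ext_coord dim_coord_subspace.
by apply: eq_card => S; rewrite !inE unfold_in.
Qed.

Lemma contract_on X p k x : x \in ext_on X p.+1 -> contract k x \in ext_on X p.
Proof.
move=> /ext_coordP h; apply/ext_coordP => U; rewrite ffunE; case: ifP => [|kU];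
  first by rewrite eqxx.
rewrite mulf_eq0 negb_or => /andP[_ /h /andP[]]; rewrite subUset cardsU1 kU add1n eqSS.
by case/andP => _ -> ->.
Qed.

Lemma wedge_on X p k x : k \in X -> x \in ext_on X p -> ext_gen K k * x \in ext_on X p.+1.
Proof.
move=> kX /ext_coordP h; apply/ext_coordP => U; rewrite ext_gen_mulE; case: ifP => kU;
  last by rewrite eqxx.
rewrite mulf_eq0 negb_or => /andP[_ /h /andP[UX /eqP <-]].
by rewrite (cardsD1 k U) kU eqxx andbT -(setD1K kU) subUset sub1set kX.
Qed.

Lemma ext_diff_on X p x : x \in ext_on X p.+1 -> ext_diff x \in ext_on X p.
Proof. by move=> xX; rewrite ext_diffE; apply: memv_suml => k _; exact: contract_on. Qed.

Lemma ext_diff_on0 X x : x \in ext_on X 0 -> ext_diff x = 0.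
Proof.
move=> /ext_coordP h; rewrite ext_diffE big1 // => k _; apply/ffunP => U; rewrite !ffunE.
case: ifP => // kU; apply/eqP; rewrite mulf_eq0; apply/orP; right.
by apply: contraT => /h; rewrite cardsU1 kU andbF.
Qed.

Local Notation kerd := (lker (linfun (@ext_diff K n))).

Lemma ext_diff_exact X p k x : k \in X -> x \in ext_on X p -> ext_diff x = 0 ->
  x = ext_diff (ext_gen K k * x).
Proof. by move=> kX xX x0; rewrite ext_diff_wedge x0 mulr0 subr0. Qed.

(** Wedging with e_k for some k in X is a contracting homotopy for the derivation, so the closed
    parts in degrees p and p + 1 add up to the whole degree p + 1 part. Pascal's rule then gives the
    dimension. *)
Lemma dim_closed_on X p : (0 < #|X|)%N -> \dim (ext_on X p :&: kerd) = 'C(#|X|.-1, p).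
Proof.
move=> /card_gt0P[k kX]; elim: p => [|p IHp].
  rewrite bin0 -(bin0 #|X|) -dim_ext_on; congr (\dim _); apply/vspaceP => x.
  rewrite memv_cap memv_ker lfunE /=; case xX: (x \in _) => //=.
  by rewrite (ext_diff_on0 xX) eqxx.
have := limg_ker_dim (linfun (@ext_diff K n)) (ext_on X p.+1).
have -> : (linfun (@ext_diff K n) @: ext_on X p.+1 = ext_on X p :&: kerd)%VS.
  apply/vspaceP => x; apply/memv_imgP/idP => [[y yX ->]|].
    by rewrite memv_cap memv_ker !lfunE /= ext_diff_on // ext_diffK ?eqxx.
  rewrite memv_cap memv_ker lfunE /= => /andP[xX /eqP x0].
  by exists (ext_gen K k * x); rewrite ?wedge_on // lfunE /= -(ext_diff_exact kX xX x0).
by rewrite IHp dim_ext_on (cardsD1 k X) kX add1n binS => /addIn.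
Qed.

Definition form_on X p q : {vspace form q} :=
  form_coord K (fun t S => [&& mon_in X t, S \subset X & #|S| == p]).

Definition closed_on X p q : {vspace form q} := (form_on X p q :&: lker (linfun (@fdiff K n q)))%VS.

Lemma closed_onP X p q f : reflect (f \in form_on X p q /\ fdiff f = 0)
  (f \in closed_on X p q).
Proof.
by rewrite memv_cap memv_ker lfunE; apply: (iffP andP) => -[? /eqP].
Qed.

Lemma dim_closed_form_on X p q : (0 < #|X|)%N ->
  \dim (closed_on X p q) = ('C(#|X| + q - 1, q) * 'C(#|X|.-1, p))%N.
Proof.
move=> X0; rewrite -(dim_closed_on p X0) -card_mon_in -sum_nat_const big_mkcond.
transitivity (\dim (pointwise (fun t : mon n q => if mon_in X t then (ext_on X p :&: kerd)%VS else 0%VS))).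
  congr (\dim _); apply/vspaceP => f; apply/closed_onP/pointwiseP.
    move=> [/form_coordP fX f0] t; case: ifP => tX.
      rewrite memv_cap memv_ker lfunE /=; have /ffunP/(_ t) := f0; rewrite !ffunE => ->.
      by rewrite eqxx andbT; apply/ext_coordP => S /fX /and3P[_ -> ->].
    rewrite memv0; apply/eqP/ffunP => S; rewrite ffunE; apply/eqP/contraT.
    by move=> /fX; rewrite tX.
  move=> h; split.
    apply/form_coordP => t S; have := h t; case: ifP => tX.
      by rewrite memv_cap => /andP[/ext_coordP + _] => /[apply].
    by rewrite memv0 => /eqP ->; rewrite ffunE eqxx.
  apply/ffunP => t; rewrite !ffunE; have := h t; case: ifP => tX.
    by rewrite memv_cap memv_ker lfunE => /andP[_ /eqP].
  by rewrite memv0 => /eqP ->; rewrite linear0.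
rewrite dim_pointwise; apply: eq_bigr => t _; rewrite inE.
by case: ifP => //; rewrite dimv0.
Qed.

Lemma kos_on X p q f : f \in form_on X p q.+1 -> kos f \in form_on X p.+1 q.
Proof.
apply: kos_coord => t k S /and3P[]; rewrite mon_in_add => /andP[kX ->] SX /eqP <- kS.
by rewrite subUset sub1set kX SX cardsU1 kS eqxx.
Qed.

Lemma cokos_on X p q f : f \in form_on X p.+1 q -> cokos f \in form_on X p q.+1.
Proof.
apply: cokos_coord => t k S /and3P[]; rewrite mon_in_add subUset sub1set cardsU1.
by move=> -> /andP[-> ->] + kS; rewrite kS.
Qed.

Lemma tder_closed X p q f : f \in closed_on X p q.+1 -> tder f \in closed_on X p q.
Proof.
move=> /closed_onP[/form_coordP fX /ffunP f0]; apply/closed_onP; split.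
  apply/form_coordP => t S; rewrite ffunE => /sum_ext_neq0[k /fX].
  by rewrite mon_in_add -andbA => /andP[].
apply/ffunP => t; rewrite !ffunE linear_sum big1 // => k _.
by have := f0 (mon_add k t); rewrite !ffunE.
Qed.

Definition xmul X q (f : form q) : form q.+1 := [ffun t => \sum_(k in X) pmul k f t].

Fact xmul_is_linear X q : linear (@xmul X q).
Proof.
move=> c f g; apply/ffunP => t; rewrite !ffunE scaler_sumr -big_split.
by apply: eq_bigr => k _; rewrite linearP !ffunE.
Qed.
HB.instance Definition _ X q := GRing.isLinear.Build K (form q) (form q.+1) *:%R
  (@xmul X q) (@xmul_is_linear X q).

Lemma xmul_closed X p q f : f \in closed_on X p q -> xmul X f \in closed_on X p q.+1.
Proof.
move=> /closed_onP[/form_coordP fX f0]; apply/closed_onP; split.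
  apply/form_coordP => t S; rewrite ffunE big_mkcond => /sum_ext_neq0[k].
  case: ifP => kX; last by rewrite ffunE eqxx.
  by move=> /pmul_neq0[s -> /fX]; rewrite mon_in_add kX.
apply/ffunP => t; rewrite !ffunE linear_sum big1 // => k _ /=.
have -> : ext_diff (pmul k f t) = pmul k (fdiff f) t by rewrite -pmul_comp.
by rewrite f0 linear0 ffunE.
Qed.

Lemma tder_xmul0 X (f : form 0) : tder (xmul X f) = #|X|%:R *: f.
Proof.
apply/ffunP => t; rewrite !ffunE; under eq_bigr => k _ do rewrite ffunE.
rewrite exchange_big -sum1_card natr_sum scaler_suml; apply: eq_bigr => k kX /=.
rewrite (bigD1 k) //= big1 => [|l lk]; rewrite -pderE pder_pmul0.
  by rewrite eqxx addr0.
by rewrite eq_sym (negPf lk) scale0r.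
Qed.

Lemma tder_xmul X q (f : form q.+1) : tder (xmul X f) = #|X|%:R *: f + xmul X (tder f).
Proof.
apply/ffunP => t; rewrite !ffunE; under eq_bigr => k _ do rewrite ffunE.
rewrite exchange_big -sum1_card natr_sum scaler_suml -big_split; apply: eq_bigr => k kX /=.
rewrite pmul_tder (bigD1 k) //= [in RHS](bigD1 k) //= -pderE pder_pmul eqxx addrA.
congr (_ + _); apply: eq_bigr => l lk.
by rewrite -pderE pder_pmul eq_sym (negPf lk) scale0r add0r.
Qed.

(** Here v is the intended value of [tder u]. The equation forces u = (g - xmul v)/(c + 1), and the
    hypothesis on v says that this u satisfies [tder u = v]. *)
Lemma xmul_tder_solve X p q c (g : form q.+1) v :
  g \in closed_on X p q.+1 -> v \in closed_on X p q ->
  tder g - tder (xmul X v) = c.+1%:R *: v ->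
  exists2 u, u \in closed_on X p q.+1 & xmul X (tder u) + c.+1%:R *: u = g.
Proof.
move=> gX vX e; exists (c.+1%:R^-1 *: (g - xmul X v)).
  by rewrite memvZ // rpredB // xmul_closed.
rewrite [tder _]linearZ linearB /= e !scalerA divff ?mulVf ?natK_neq0 // !scale1r.
by rewrite addrC subrK.
Qed.

(* Since tder (xmul f) = xmul (tder f) + #|X| f, the operator xmul \o tder + c
   is inverted for all c > 0 by induction on the degree. *)
Lemma xmul_tder_surj X p q c g : (0 < #|X|)%N -> g \in closed_on X p q.+1 ->
  exists2 u, u \in closed_on X p q.+1 & xmul X (tder u) + c.+1%:R *: u = g.
Proof.
move=> X0; elim: q c g => [|q IHq] c g gX.
all: have gX' := tder_closed gX.
  pose v := (c.+1 + #|X|)%:R^-1 *: tder g.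
  have vX : v \in closed_on X p 0 by rewrite memvZ.
  apply: (xmul_tder_solve gX vX); rewrite tder_xmul0.
  have -> : tder g = (c.+1 + #|X|)%:R *: v.
    by rewrite scalerA divff ?scale1r // addSn natK_neq0.
  by rewrite natrD scalerDl addrK.
have [v vX ev] := IHq (c + #|X|)%N _ gX'.
apply: (xmul_tder_solve gX vX); rewrite tder_xmul -ev -addSn natrD scalerDl.
by rewrite [X in _ - X]addrC opprD addrACA subrr add0r addrK.
Qed.

(** In positive degree a preimage is [xmul u], where u solves the preceding equation with c =
    #|X|. *)
Lemma tder_surj X p q g : (0 < #|X|)%N -> g \in closed_on X p q ->
  exists2 f, f \in closed_on X p q.+1 & g = tder f.
Proof.
move=> X0; have X1 : #|X| = #|X|.-1.+1 by rewrite prednK.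
case: q g => [|q] g gX.
  exists (#|X|%:R^-1 *: xmul X g); first by rewrite memvZ // xmul_closed.
  by rewrite linearZ /= tder_xmul0 scalerA X1 mulVf ?scale1r // natK_neq0.
have [u uX <-] := xmul_tder_surj #|X|.-1 X0 gX; exists (xmul X u); first exact: xmul_closed.
by rewrite tder_xmul -X1 addrC.
Qed.

(** The conditions [fdiff f = 0] and [tder f = 0] are jointly stable under both [kos] and [cokos],
    so these forms are a subcomplex that inherits Euler's homotopy. *)
Definition basic_on X p q : {vspace form q.+1} :=
  (closed_on X p q.+1 :&: lker (linfun (@tder K n q)))%VS.

Lemma basic_onP X p q f :
  reflect (f \in closed_on X p q.+1 /\ tder f = 0) (f \in basic_on X p q).
Proof.
by rewrite [f \in basic_on _ _ _]memv_cap memv_ker lfunE; apply: (iffP andP) => -[? /eqP].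
Qed.

Lemma dim_basic_on X p q : (0 < #|X|)%N ->
  (\dim (basic_on X p q) + 'C(#|X| + q - 1, q) * 'C(#|X|.-1, p) =
   'C(#|X| + q, q.+1) * 'C(#|X|.-1, p))%N.
Proof.
move=> X0; have := limg_ker_dim (linfun (@tder K n q)) (closed_on X p q.+1).
rewrite dim_closed_form_on // addnS subn1 => <-; congr (_ + _)%N.
rewrite -dim_closed_form_on //; congr (\dim _); apply/vspaceP => g; apply/idP/memv_imgP.
  by move=> /(tder_surj X0)[f fX ->]; exists f => //; rewrite lfunE.
by move=> [f fX ->]; rewrite lfunE tder_closed.
Qed.

Lemma kos_basic X p q : (linfun (@kos K n q.+1) @: basic_on X p q.+1 =
  basic_on X p.+1 q :&: lker (linfun (@kos K n q)))%VS.
Proof.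
apply/vspaceP => f; apply/memv_imgP/idP => [[g + ->]|].
  move=> /basic_onP[/closed_onP[gX g0] g1];
    rewrite memv_cap memv_ker !lfunE /= kos_kos // eqxx andbT.
  apply/basic_onP; split; last by rewrite tder_kos g1 linear0.
  by apply/closed_onP; rewrite kos_on // fdiff_kos g0 g1 linear0 subrr.
rewrite memv_cap memv_ker lfunE /= => /andP[/basic_onP[/closed_onP[fX f0] f1] /eqP f2].
exists ((p.+1 + q.+1)%:R^-1 *: cokos f).
  rewrite memvZ //; apply/basic_onP; split; last by rewrite tder_cokos f0 f1 linear0 addr0.
  by apply/closed_onP; rewrite cokos_on // fdiff_cokos f0 linear0 oppr0.
rewrite lfunE /= linearZ /=; apply/ffunP => t; apply/ffunP => S.
have := kos_cokos f t S;
  rewrite f2 linear0 [(0 : form _) t]ffunE [(0 : E) S]ffunE addr0 => e.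
rewrite [(_ *: kos _) t]ffunE [(_ *: kos _ t) S]ffunE e /GRing.scale /=.
have [->|/(form_coordP _ _ fX)/and3P[_ _ /eqP ->]] := eqVneq (f t S) 0;
  first by rewrite !mulr0.
by rewrite mulrA mulVf ?mul1r // natK_neq0.
Qed.

Definition local_syzygies X q : {vspace form q.+1} :=
  (closed_on X 2%N q.+1 :&: lker (linfun (@kos K n q)))%VS.

(** A form killed by [fdiff] and [kos] is killed by their anticommutator [tder], hence is a basic
    cycle, and basic cycles are boundaries by [kos_basic]. *)
Lemma local_syzygiesE X q :
  local_syzygies X q = (linfun (@kos K n q.+1) @: basic_on X 1%N q.+1)%VS.
Proof.
rewrite kos_basic; apply/vspaceP => f; rewrite [in LHS]memv_cap [in RHS]memv_cap.
rewrite memv_ker lfunE /=; case: eqP => [f0|]; rewrite ?andbF // !andbT.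
apply/idP/basic_onP => [fX|[] //]; split=> //.
have /closed_onP[_ f1] := fX; have := fdiff_kos f; rewrite f0 f1 !linear0 addr0.
by [].
Qed.

(** The strand is the cokernel of the injection [kos] from basic forms of exterior degree 0 to those
    of exterior degree 1; both dimensions come from [dim_basic_on]. *)
Lemma dim_local_syzygies X q : (0 < #|X|)%N ->
  \dim (local_syzygies X q) = (q.+2 * 'C(#|X|.-1 + q.+1, q.+3))%N.
Proof.
move=> X0.
have e : (\dim (basic_on X 0 q.+2) + \dim (local_syzygies X q) = \dim (basic_on X 1 q.+1))%N.
  have := limg_ker_dim (linfun (@kos K n q.+1)) (basic_on X 1 q.+1).
  rewrite -local_syzygiesE -kos_basic limg_dim_eq //.
  apply/eqP; rewrite -subv0; apply/subvP => f; rewrite memv_cap memv_ker lfunE memv0 /=.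
  case/andP => /basic_onP[/closed_onP[fX _] _] /eqP f0; apply/eqP.
  apply: (kos_inj charK) f0; apply/form_coordP => t S /(form_coordP _ _ fX).
  by case/and3P.
have e1 := dim_basic_on 1 q.+1 X0; have e0 := dim_basic_on 0 q.+2 X0.
move: (\dim (basic_on X 0 q.+2)) (\dim (basic_on X 1 q.+1)) (\dim (local_syzygies X q)) e e0 e1.
move=> d0 d1 d2; case: #|X| X0 => // m _ /=.
rewrite bin0 bin1 !muln1 !addSn !addnS !subn1 /= !binS.
have := mul_bin_left (m + q).+1 q.+2.
rewrite (_ : ((m + q).+1 - q.+2 = m - 1)%N); last by lia.
(* For m = 0, that is #|X| = 1, the subtraction [m - 1] is truncated, and the binomials at stake
   vanish. *)
case: m => [|m].
  have c d : 'C(q, (q + d).+1) = 0%N by apply: bin_small; lia.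
  have := c 0%N; have := c 1%N; have := c 2%N.
  by rewrite !addnS addn0 !add0n => -> -> ->; lia.
by rewrite binS subn1 [in X in _ = X -> _]binS /=; nia.
Qed.

End LocalForms.

(** * Blocks of a linear space on the generators, and prolongation of local syzygies *)

Section LinearSpace.
Variables (K : fieldType) (n : nat).
Hypothesis charK : [pchar K] =i pred0.
Local Notation E := (exterior K n).
Local Notation form q := {ffun mon n q -> E}.
Implicit Types (k l : 'I_n) (S U X : {set 'I_n}).
Variables (T : finType) (H : T -> {set 'I_n}).
Hypothesis H_exists : forall k l, k != l -> exists x, (k \in H x) && (l \in H x).
Hypothesis H_unique : forall k l x y, k != l -> k \in H x -> l \in H x ->
  k \in H y -> l \in H y -> x = y.
Hypothesis H_gt0 : forall x, (0 < #|H x|)%N.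

(** The projection that sets e_k to 0 for k outside X. *)
Definition restrict X (v : E) : E :=
  [ffun S : {set 'I_n} => if S \subset X then v S else 0 : K^o].

Fact restrict_is_linear X : linear (restrict X).
Proof.
move=> c u v; apply/ffunP => S; rewrite !ffunE; case: ifP => // _.
by rewrite scaler0 addr0.
Qed.
HB.instance Definition _ X :=
  GRing.isLinear.Build K E E *:%R (restrict X) (restrict_is_linear X).

Lemma restrict_on X p v : v \in ext_on K setT p -> restrict X v \in ext_on K X p.
Proof.
move=> /ext_coordP h; apply/ext_coordP => S; rewrite ffunE; case: ifP => [_ /h|];
  last by rewrite eqxx.
by rewrite subsetT.
Qed.

Lemma on_setT X p v : v \in ext_on K X p -> v \in ext_on K setT p.
Proof. by move=> /ext_coordP h; apply/ext_coordP => S /h /andP[_ ->]; rewrite subsetT. Qed.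

Lemma restrict_id X p v : v \in ext_on K X p -> restrict X v = v.
Proof.
move=> /ext_coordP h; apply/ffunP => S; rewrite ffunE; case: ifP => // /negP SX.
by apply/esym/eqP/contraT => /h /andP[].
Qed.

Lemma block_unique S x y : #|S| = 2 -> S \subset H x -> S \subset H y -> x = y.
Proof.
move=> /eqP/cards2P[k [l [kl ->]]]; rewrite !subUset !sub1set.
by move=> /andP[kx lx] /andP[ky ly]; apply: H_unique kl kx lx ky ly.
Qed.

Lemma restrict_other x y v : x != y -> v \in ext_on K (H x) 2 -> restrict (H y) v = 0.
Proof.
move=> xy /ext_coordP h; apply/ffunP => S; rewrite !ffunE; case: ifP => // Sy.
apply/eqP; apply: contraNT xy => /h /andP[Sx /eqP S2]; apply/eqP.
exact: block_unique S2 Sx Sy.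
Qed.

(** Each pair of indices lies in exactly one block. *)
Lemma sum_restrict v : v \in ext_on K setT 2 -> v = \sum_x restrict (H x) v.
Proof.
move=> /ext_coordP h; apply/ffunP => S; rewrite sum_ffunE.
have [v0|/h /andP[_ /eqP S2]] := eqVneq (v S) 0.
  by rewrite v0 big1 // => x _; rewrite ffunE v0 if_same.
have [x Sx] : exists x, S \subset H x.
  have /eqP/cards2P[k [l [/H_exists[x xkl] ->]]] := S2.
  by exists x; rewrite subUset !sub1set.
rewrite (bigD1 x) //= ffunE Sx big1 ?addr0 // => y yx; rewrite ffunE; case: ifP => // Sy.
by rewrite (block_unique S2 Sx Sy) eqxx in yx.
Qed.

(** For the pencils of an arrangement this is the degree 2 part of the Orlik-Solomon ideal, by
    [OS_ideal_local_relations]. *)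
Definition local_relations : {vspace E} :=
  (ext_on K setT 2%N :&: \bigcap_x lker (linfun (@ext_diff K n) \o linfun (restrict (H x))))%VS.

Lemma local_relationsP v : reflect (v \in ext_on K setT 2 /\
    forall x, ext_diff (restrict (H x) v) = 0) (v \in local_relations).
Proof.
rewrite memv_cap; apply: (iffP andP) => -[vT h]; split=> //.
  move=> x; have : (<[v]> <= \bigcap_x lker (linfun (@ext_diff K n) \o linfun (restrict (H x))))%VS.
    by rewrite -memvE.
  move/subv_bigcapP/(_ x isT); rewrite -memvE memv_ker comp_lfunE !lfunE /= => /eqP.
  by [].
rewrite memvE; apply/subv_bigcapP => x _; rewrite -memvE memv_ker.
by rewrite comp_lfunE !lfunE /= h.
Qed.

Lemma local_relations_on x v : v \in ext_on K (H x) 2 -> ext_diff v = 0 ->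
  v \in local_relations.
Proof.
move=> vx v0; apply/local_relationsP; split; first exact: on_setT vx.
move=> y; have [<-|xy] := eqVneq x y; first by rewrite (restrict_id vx).
by rewrite (restrict_other xy vx) linear0.
Qed.

(** The closed 2-vectors of the blocks form a direct sum: restriction to one block isolates its
    summand. *)
Lemma dim_local_relations : \dim local_relations = (\sum_x 'C(#|H x|.-1, 2))%N.
Proof.
have -> : local_relations = (\sum_x (ext_on K (H x) 2%N :&: lker (linfun (@ext_diff K n))))%VS.
  apply/eqP; rewrite eqEsubv; apply/andP; split.
    apply/subvP => v /local_relationsP[vT v0]; rewrite (sum_restrict vT).
    apply: memv_sumr => x _; rewrite memv_cap memv_ker lfunE /= v0 eqxx.
    by rewrite restrict_on.
  apply/subv_sumP => x _; apply/subvP => v;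
    rewrite memv_cap memv_ker lfunE => /andP[vx /eqP].
  exact: (local_relations_on vx).
under [RHS]eq_bigr => x _ do rewrite -(dim_closed_on charK 2%N (H_gt0 x)).
apply/directvP/directv_sum_independent => us usP us0 x _.
have usx y : us y \in ext_on K (H y) 2 by have := usP y isT; rewrite memv_cap => /andP[].
have := congr1 (restrict (H x)) us0; rewrite linear0 linear_sum (bigD1 x) //= big1 ?addr0.
  by rewrite (restrict_id (usx x)).
by move=> y yx; rewrite (restrict_other yx (usx y)).
Qed.

Definition restrict_form X q (f : form q) : form q := [ffun t => restrict X (f t)].

Fact restrict_form_is_linear X q : linear (@restrict_form X q).
Proof. by move=> c f g; apply/ffunP => t; rewrite !ffunE linearP. Qed.
HB.instance Definition _ X q := GRing.isLinear.Build K (form q) (form q) *:%R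
  (@restrict_form X q) (@restrict_form_is_linear X q).

Lemma closed_on_ext X p q f t : f \in closed_on K X p q -> f t \in ext_on K X p.
Proof. by move=> /closed_onP[/form_coordP fX _];
  apply/ext_coordP => S /fX /and3P[_ -> ->]. Qed.

Lemma restrict_form_id X q f : f \in closed_on K X 2 q -> restrict_form X f = f.
Proof.
by move=> fX; apply/ffunP => t; rewrite ffunE (restrict_id (closed_on_ext t fX)).
Qed.

Lemma restrict_form_other x y q f : x != y -> f \in closed_on K (H x) 2 q ->
  restrict_form (H y) f = 0.
Proof.
by move=> xy fX; apply/ffunP => t; rewrite !ffunE (restrict_other xy (closed_on_ext t fX)).
Qed.

Definition linear_syzygies q : {vspace form q.+1} :=
  (pointwise (fun=> local_relations) :&: lker (linfun (@kos K n q)))%VS.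

Definition sum_local_syzygies q : {vspace form q.+1} := (\sum_x local_syzygies K (H x) q)%VS.

Lemma sum_local_syzygies_sub q : (sum_local_syzygies q <= linear_syzygies q)%VS.
Proof.
apply/subv_sumP => x _; apply/subvP => f; rewrite [f \in local_syzygies _ _ _]memv_cap.
case/andP => fX f0; rewrite memv_cap f0 andbT.
apply/pointwiseP => t; apply: (local_relations_on (closed_on_ext t fX)).
by have /closed_onP[_ /ffunP/(_ t)] := fX; rewrite !ffunE.
Qed.

Lemma dim_sum_local_syzygies q :
  \dim (sum_local_syzygies q) = (\sum_x q.+2 * 'C(#|H x|.-1 + q.+1, q.+3))%N.
Proof.
under [RHS]eq_bigr => x _ do rewrite -(dim_local_syzygies charK q (H_gt0 x)).
apply/directvP/directv_sum_independent => us usP us0 x _.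
have usx y : us y \in closed_on K (H y) 2 q.+1.
  by have := usP y isT; rewrite memv_cap => /andP[].
have := congr1 (@restrict_form (H x) _) us0;
  rewrite linear0 linear_sum (bigD1 x) //= big1 ?addr0.
  by rewrite (restrict_form_id (usx x)).
by move=> y yx; rewrite (restrict_form_other yx (usx y)).
Qed.

Lemma restrict_form_sum_local x q f : f \in sum_local_syzygies q ->
  restrict_form (H x) f \in local_syzygies K (H x) q.
Proof.
case/memv_sumP => us usP ->; rewrite linear_sum (bigD1 x) //= big1 ?addr0.
  have := usP x isT; rewrite memv_cap => /andP[/restrict_form_id usx _].
  by rewrite usx usP.
move=> y yx; have := usP y isT; rewrite memv_cap => /andP[ux _].
by rewrite (restrict_form_other yx ux).
Qed.

Lemma restrict_form_pder x q k (f : form q.+1) :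
  restrict_form (H x) (pder k f) = pder k (restrict_form (H x) f).
Proof. by apply/ffunP => t; rewrite !ffunE. Qed.

(** Every monomial here has positive degree, so each coefficient of f is a coefficient of some
    derivative of f. *)
Lemma local_syzygies_pder X q f : (forall k, pder k f \in local_syzygies K X q) ->
  f \in local_syzygies K X q.+1.
Proof.
move=> h; have h1 k : pder k f \in closed_on K X 2 q.+1.
  by have := h k; rewrite memv_cap => /andP[].
rewrite memv_cap memv_ker lfunE /=; apply/andP; split; last first.
  apply/eqP/ffunP => t; have [k [s ->]] := mon_succ t; rewrite -pderE -kos_pder.
  have := h k; rewrite memv_cap memv_ker lfunE => /andP[_ /eqP /= ->].
  by rewrite !ffunE.
apply/closed_onP; split; last first.
  apply/ffunP => t; have [k [s ->]] := mon_succ t.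
  by have /closed_onP[_ /ffunP/(_ s)] := h1 k; rewrite !ffunE.
apply/form_coordP => t S ftS; have [k [s e]] := mon_succ t.
have /closed_onP[/form_coordP/(_ s S) + _] := h1 k; rewrite pderE -e => /(_ ftS).
case/and3P => _ -> ->; rewrite !andbT; apply/negPn/negP => /mon_inPn[l lX [s' e']].
(* The degree of t is at least 2, so a variable k' remains besides x_l; the derivative along k'
   still involves x_l, although l is outside X. *)
have [k' [s'' e'']] := mon_succ s'.
have /closed_onP[/form_coordP/(_ (mon_add l s'') S) + _] := h1 k'.
by rewrite pderE mon_addC -e'' -e' => /(_ ftS) /and3P[]; rewrite mon_in_add (negPf lX).
Qed.

(** Derivatives of linear syzygies are linear syzygies and hence local by assumption; restricting to
    a block commutes with differentiation, so each block component of f has local derivatives. *)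
Lemma linear_syzygies_prolong q : (linear_syzygies q <= sum_local_syzygies q)%VS ->
  (linear_syzygies q.+1 <= sum_local_syzygies q.+1)%VS.
Proof.
move=> hq; apply/subvP => f;
  rewrite memv_cap memv_ker lfunE /= => /andP[/pointwiseP fT /eqP f0].
have -> : f = \sum_x restrict_form (H x) f.
  apply/ffunP => t; rewrite sum_ffunE; have /local_relationsP[/sum_restrict + _] := fT t.
  by move=> {1}->; apply: eq_bigr => x _; rewrite ffunE.
apply: memv_sumr => x _; apply: local_syzygies_pder => k; rewrite -restrict_form_pder.
apply/restrict_form_sum_local/(subvP hq); rewrite memv_cap memv_ker lfunE /=.
rewrite kos_pder f0 linear0 eqxx andbT; apply/pointwiseP => t.
by rewrite pderE.
Qed.

End LinearSpace.

(** * The Orlik-Solomon ideal in rank three *)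

Section RankThreeLattice.
Variables (F : fieldType) (n : nat) (A : arrangement F 3 n).
Implicit Types (i k : 'I_n) (J : {set 'I_n}) (X : {vspace 'rV[F]_3}).

Lemma dim_hyperplane i : \dim (A i) = 2.
Proof. by have := hyperplane_codim1 A i; case. Qed.

Lemma dim_le3 X : (\dim X <= 3)%N.
Proof. by have := dimvS (subvf X); rewrite dimvf /dim /= mul1n. Qed.

Lemma dim_meet2 i k : i != k -> \dim (A i :&: A k) = 1.
Proof.
move=> ik; have := dimv_sum_cap (A i) (A k); rewrite !dim_hyperplane.
have := dim_le3 (A i + A k)%VS.
suff : (2 < \dim (A i + A k))%N by lia.
rewrite ltnNge; apply: contra ik => d2; apply/eqP/(@hyperplane_inj _ _ _ A)/eqP.
have e : (A i == A i + A k)%VS by rewrite eqEdim addvSl dim_hyperplane.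
by rewrite eq_sym eqEdim !dim_hyperplane leqnn andbT (eqP e) addvSr.
Qed.

Lemma flat2 i k : flat A [set i; k] = (A i :&: A k)%VS.
Proof.
rewrite /flat; have [->|ik] := eqVneq i k; first by rewrite setUid big_set1 capvv.
by rewrite big_setU1 ?inE // big_set1.
Qed.

Lemma L2_dim X : X \in L2 A -> \dim X = 1.
Proof.
rewrite mem_filter => /andP[/eqP + _]; rewrite /codim; have := dim_le3 X; lia.
Qed.

Lemma L2_flat2 i k : i != k -> (A i :&: A k)%VS \in L2 A.
Proof.
move=> ik; rewrite mem_filter /codim dim_meet2 // mem_undup -flat2.
by apply/mapP; exists [set i; k]; rewrite ?mem_enum.
Qed.

Lemma L2_unique i k X : i != k -> X \in L2 A -> (X <= A i)%VS -> (X <= A k)%VS ->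
  X = (A i :&: A k)%VS.
Proof.
move=> ik XL Xi Xk; apply/eqP; rewrite eqEdim subv_cap Xi Xk.
by rewrite dim_meet2 // (L2_dim XL).
Qed.

Lemma flat_sub J i : i \in J -> (flat A J <= A i)%VS.
Proof. by move=> iJ; apply: bigcapv_inf iJ _. Qed.

Lemma dependent_gt2 J : dependent A J -> (2 < #|J|)%N.
Proof.
rewrite /dependent; apply: contraTT; rewrite -!leqNgt.
case: (posnP #|J|) => [-> //|J0 J2].
have [/eqP|ne1] := eqVneq #|J| 1%N.
  by move/cards1P => [i ->]; rewrite /flat big_set1 /codim dim_hyperplane cards1.
have /cards2P[i [k [ik ->]]] : #|J| == 2 by lia.
by rewrite flat2 /codim dim_meet2 // cards2 ik.
Qed.

Lemma dependent_gt3 J : (3 < #|J|)%N -> dependent A J.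
Proof. by apply: leq_ltn_trans; apply: leq_subr. Qed.

Lemma dependent_L2 J X : X \in L2 A -> (2 < #|J|)%N -> (forall i, i \in J -> (X <= A i)%VS) ->
  dependent A J.
Proof.
move=> XL J3 XJ; apply: leq_ltn_trans J3; rewrite /codim.
have : (X <= flat A J)%VS by apply/subv_bigcapP => i iJ; apply: XJ.
move/dimvS; rewrite (L2_dim XL); lia.
Qed.

(** A dependent triple spans rank 2, so its flat is already the meet of any two of its planes. *)
Lemma dependent3 J : dependent A J -> #|J| = 3 ->
  exists2 X, X \in L2 A & forall i, i \in J -> (X <= A i)%VS.
Proof.
rewrite /dependent /codim => + J3; rewrite J3 => dJ.
have /card_gt1P[i [k [iJ kJ ik]]] : (1 < #|J|)%N by rewrite J3.
exists (flat A J); last exact: flat_sub.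
suff -> : flat A J = (A i :&: A k)%VS by exact: L2_flat2.
apply/eqP; rewrite eqEdim subv_cap !flat_sub // dim_meet2 //; lia.
Qed.

(** Indexing by positions in [L2 A] turns the pencils into a family over a finite type, as the
    linear space above requires. *)
Definition pencil (x : 'I_(size (L2 A))) : {set 'I_n} :=
  [set i | (tnth (in_tuple (L2 A)) x <= A i)%VS].

Lemma pencil_exists i k : i != k -> exists x, (i \in pencil x) && (k \in pencil x).
Proof.
move=> ik; have /tnthP[x xE] : (A i :&: A k)%VS \in in_tuple (L2 A) by exact: L2_flat2.
by exists x; rewrite !inE -xE capvSl capvSr.
Qed.

Lemma pencil_unique i k x y : i != k -> i \in pencil x -> k \in pencil x ->
  i \in pencil y -> k \in pencil y -> x = y.
Proof.
rewrite !inE => ik xi xk yi yk; apply/val_inj/eqP.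
rewrite -(nth_uniq fullv (ltn_ord x) (ltn_ord y)) ?filter_uniq ?undup_uniq //.
rewrite -!(tnth_nth _ (in_tuple (L2 A))) (L2_unique ik _ xi xk) ?mem_tnth //.
by rewrite -(L2_unique ik _ yi yk) ?mem_tnth.
Qed.

Lemma pencil_gt0 x : (0 < #|pencil x|)%N.
Proof.
have := mem_tnth x (in_tuple (L2 A)); rewrite /pencil; move: (tnth _ x) => X XL.
have := XL; rewrite mem_filter => /andP[_]; rewrite mem_undup => /mapP[J _ XJ].
have [J0|[i iJ]] := set_0Vmem J.
  have := L2_dim XL; rewrite XJ J0 /flat big_set0 dimvf /dim /= mul1n //.
by apply/card_gt0P; exists i; rewrite inE XJ flat_sub.
Qed.

Lemma sum_pencil (f : nat -> nat) :
  (\sum_(X <- L2 A) f (mu A X) = \sum_x f (#|pencil x|.-1))%N.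
Proof. by rewrite big_tnth. Qed.

Lemma pencil_dependent x J : (2 < #|J|)%N -> J \subset pencil x -> dependent A J.
Proof.
move=> J3 /subsetP Jx; apply: (@dependent_L2 J (tnth (in_tuple (L2 A)) x)) => //.
  exact: (mem_tnth x (in_tuple (L2 A))).
by move=> i /Jx; rewrite inE.
Qed.

Lemma dependent_pencil J : dependent A J -> #|J| = 3 -> exists x, J \subset pencil x.
Proof.
move=> dJ /(dependent3 dJ)[X XL XJ]; have /tnthP[x xE] : X \in in_tuple (L2 A) by [].
by exists x; apply/subsetP => i /XJ; rewrite inE -xE.
Qed.

End RankThreeLattice.

(** * Low degrees of the Orlik-Solomon ideal *)

Section OrlikSolomonIdeal.
Variables (F : fieldType) (n : nat) (A : arrangement F 3 n) (K : fieldType).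
Hypothesis charK : [pchar K] =i pred0.
Local Notation E := (exterior K n).
Local Notation I := (OS_ideal A K).
Local Notation b := (ext_basis K).
Implicit Types (S J U : {set 'I_n}) (x y : E).

Lemma OS_ideal_gen x J y : dependent A J -> x * ext_diff (b J) * y \in I.
Proof.
move=> dJ; apply: memv_mul; last exact: memvf.
apply: memv_mul; first exact: memvf.
by apply/memv_span/mapP; exists J; rewrite // mem_enum.
Qed.

Lemma ext_diff_OS J : dependent A J -> ext_diff (b J) \in I.
Proof. by move=> /(OS_ideal_gen 1 1); rewrite mul1r mulr1. Qed.

Lemma OS_ideal_mull x y : y \in I -> x * y \in I.
Proof.
move=> yI; have := memv_mul (memvf x) yI; apply: subvP.
by rewrite /OS_ideal !prodvA; do 2!apply: prodvSl; apply: subvf.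
Qed.

Fact mul_between_linear u v : linear (fun x : E => u * x * v).
Proof. by move=> c x y; rewrite mulrDr mulrDl scalerAl scalerAr. Qed.

(** Homogeneous spanning elements: inclusions of the ideal are all tested on these. *)
Lemma OS_ideal_sub (Q : {vspace E}) :
  (forall S J U, dependent A J -> b S * ext_diff (b J) * b U \in Q) -> (I <= Q)%VS.
Proof.
move=> h; apply/prodvP => u y uI _; rewrite [y]ext_sum_basis mulr_sumr.
apply: memv_suml => U _; rewrite -scalerAr memvZ //.
suff /subvP/(_ u uI) : ({:E} * <<[seq ext_diff (b J) | J in dependent A]>>
    <= mklfun (mul_between_linear 1 (b U)) @^-1: Q)%VS.
  by rewrite -memv_preim mklfunE mul1r.
apply/prodvP => x g _ gG; rewrite -memv_preim mklfunE mul1r [x]ext_sum_basis !mulr_suml.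
apply: memv_suml => S _; rewrite -!scalerAl memvZ //.
suff /subvP/(_ g gG) : (<<[seq ext_diff (b J) | J in dependent A]>>
    <= mklfun (mul_between_linear (b S) (b U)) @^-1: Q)%VS.
  by rewrite -memv_preim mklfunE.
apply/span_subvP => _ /mapP[J JA ->]; rewrite -memv_preim mklfunE; apply: h.
by rewrite mem_enum in JA.
Qed.

Lemma ext_homogM p q x y : ext_homog p x -> ext_homog q y -> ext_homog (p + q) (x * y).
Proof.
move=> hx hy U; rewrite ffunE => /eqP Uxy; apply/eqP; apply: contra_notT Uxy => Upq.
apply: big1 => S SU; have [->|/hx xS] := eqVneq (x S) 0; first by rewrite mulr0 mul0r.
have [->|/hy yS] := eqVneq (y (U :\: S)) 0; first by rewrite mulr0.
by case/eqP: Upq; rewrite -(cardsID S U) (setIidPr SU) xS yS.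
Qed.

Lemma ext_homog_basis S : ext_homog #|S| (b S).
Proof. by move=> U; rewrite ffunE; case: (eqVneq U S) => [->|]; rewrite ?eqxx. Qed.

Lemma ext_homog_diff_basis J : ext_homog #|J|.-1 (ext_diff (b J)).
Proof.
move=> U; rewrite ext_diffE => /sum_ext_neq0[k]; rewrite ffunE; case: ifP => [|kU];
  rewrite ?eqxx //.
rewrite mulf_eq0 negb_or => /andP[_]; rewrite ffunE.
by case: (eqVneq (k |: U) J) => [<- _|]; rewrite ?eqxx // cardsU1 kU.
Qed.

Lemma ext_homog_OS_gen S J U :
  ext_homog (#|S| + #|J|.-1 + #|U|) (b S * ext_diff (b J) * b U).
Proof.
apply: ext_homogM (@ext_homog_basis U); apply: ext_homogM; first exact: ext_homog_basis.
exact: ext_homog_diff_basis.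
Qed.

Lemma ext_basis0 : b (set0 : {set 'I_n}) = 1.
Proof. by []. Qed.

Lemma OS_ideal_truncate j q y : y \in I -> truncate j q 0 y \in I.
Proof.
suff /subvP/(_ y) h : (I <= linfun (@truncate K n j q 0) @^-1: I)%VS.
  by move=> /h; rewrite -memv_preim lfunE.
apply: OS_ideal_sub => S J U dJ; rewrite -memv_preim lfunE /=.
have hom := @ext_homog_OS_gen S J U; set z := _ * b U in hom *.
have zI : z \in I by exact: OS_ideal_gen.
have [e|ne] := eqVneq (#|S| + #|J|.-1 + #|U| + q + 0)%N j.
  by rewrite truncate_id //; apply/ext_coordP => V /hom ->; rewrite e.
rewrite (_ : truncate _ _ _ z = 0) ?mem0v //; apply/ffunP => V;
  rewrite [LHS]ffunE [RHS]ffunE.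
case: eqP => // e; apply/eqP; apply: contraT => /hom eV.
by rewrite -eV e eqxx in ne.
Qed.

Lemma OS_ideal_comp d y : y \in I -> ext_comp d y \in I.
Proof.
move=> /(@OS_ideal_truncate d 0); rewrite (_ : truncate _ _ _ _ = ext_comp d y) //.
by apply/ffunP => S; rewrite !ffunE !addn0.
Qed.

Lemma ext_diff_OS_ideal y : y \in I -> ext_diff y \in I.
Proof.
suff /subvP/(_ y) h : (I <= linfun (@ext_diff K n) @^-1: I)%VS.
  by move=> /h; rewrite -memv_preim lfunE.
apply: OS_ideal_sub => S J U dJ; rewrite -memv_preim lfunE /= -mulrA.
rewrite (ext_diffM _ (ext_homog_basis (S := S))) (ext_diffM _ (ext_homog_diff_basis (J := J))).
rewrite ext_diffK // mul0r add0r rpredD //; first by rewrite mulrA OS_ideal_gen.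
do 3!apply: OS_ideal_mull; rewrite -[ext_diff (b J)]mul1r; exact: OS_ideal_gen.
Qed.

Local Notation H := (@pencil F n A).

Lemma ext_basis_on S (X : {set 'I_n}) : S \subset X -> b S \in ext_on K X #|S|.
Proof.
by move=> SX; apply/ext_coordP => U; rewrite ffunE; case: (eqVneq U S) => [->|];
  rewrite ?SX ?eqxx.
Qed.

Lemma OS_ideal_low y S : y \in I -> (#|S| < 2)%N -> y S = 0.
Proof.
move=> yI S2; suff /subvP/(_ y yI)/ext_coordP h : (I <= ext_coord K (fun S => 1 < #|S|)%N)%VS.
  by apply/eqP/contraT => /h; rewrite ltnNge -ltnS S2.
apply: OS_ideal_sub => S' J U /dependent_gt2 J3; apply/ext_coordP => V.
by move/ext_homog_OS_gen => ->; lia.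
Qed.

(** By degree, the generators in degree 2 are the derivations of dependent triples, and each triple
    lies in a pencil. Conversely, a closed restriction z to a pencil is the derivation of e_k z, a
    combination of triples of that pencil. *)
Lemma OS_ideal_local_relations y : y \in ext_on K setT 2 ->
  (y \in I) = (y \in local_relations K H).
Proof.
move=> y2; apply/idP/idP => [yI|/local_relationsP[_ y0]].
  have : truncate 2 0 0 y \in local_relations K H; last first.
    by rewrite truncate_id //; apply/ext_coordP => S; move/ext_coordP: y2 => h /h;
      rewrite !addn0 => /andP[].
  suff /subvP/(_ y yI) : (I <= linfun (@truncate K n 2 0 0) @^-1: local_relations K H)%VS.
    by rewrite -memv_preim lfunE.
  apply: OS_ideal_sub => S J U dJ; rewrite -memv_preim lfunE /=.
  have hom := @ext_homog_OS_gen S J U; have J3 := dependent_gt2 dJ.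
  have [e|ne] := eqVneq (#|S| + #|J|.-1 + #|U|)%N 2; last first.
    rewrite (_ : truncate _ _ _ _ = 0) ?mem0v //; apply/ffunP => V;
      rewrite [LHS]ffunE [RHS]ffunE !addn0.
    case: eqP => // e; apply/eqP; apply: contraT => /hom eV.
    by rewrite -eV e eqxx in ne.
  rewrite truncate_id; last by apply/ext_coordP => V /hom ->; rewrite !addn0 e.
  have [/cards0_eq -> /cards0_eq -> J3'] : [/\ #|S| = 0, #|U| = 0 & #|J| = 3]%N by split;
    lia.
  rewrite !ext_basis0 mul1r mulr1; have [x Jx] := dependent_pencil dJ J3'.
  apply: (local_relations_on (@pencil_unique _ _ A) (x := x)); last exact: ext_diffK.
  by apply: ext_diff_on; rewrite -J3'; exact: ext_basis_on.
rewrite (sum_restrict (@pencil_exists _ _ A) (@pencil_unique _ _ A) y2).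
apply: memv_suml => x _; have /card_gt0P[k kx] := pencil_gt0 x.
have rx := restrict_on (H x) y2.
rewrite (ext_diff_exact kx rx (y0 x)); have := wedge_on kx rx.
move: (_ * restrict _ _) => z /ext_coordP z3; rewrite [z]ext_sum_basis linear_sum.
apply: memv_suml => S _; rewrite linearZ /=;
  have [->|/z3 /andP[Sx /eqP S3]] := eqVneq (z S) 0.
  by rewrite scale0r mem0v.
by rewrite memvZ // ext_diff_OS // (pencil_dependent (x := x)) // S3.
Qed.

(** Any four planes in 3-space are dependent, and e_S = e_k times the derivation of e_S for k in
    S. *)
Lemma OS_ideal_deg4 y : y \in ext_on K setT 4 -> y \in I.
Proof.
move=> /ext_coordP y4; rewrite [y]ext_sum_basis; apply: memv_suml => S _.
have [->|/y4 /andP[_ /eqP S4]] := eqVneq (y S) 0; first by rewrite scale0r mem0v.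
have [k kS] : exists k, k \in S by apply/card_gt0P; rewrite S4.
have eS : ext_gen K k * b S = 0.
  apply/ffunP => U; rewrite ext_gen_mulE [RHS]ffunE; case: ifP => // kU; rewrite ffunE.
  have [e|_] := eqVneq (U :\ k) S; last by rewrite mulr0.
  by rewrite -e !inE eqxx in kS.
have := ext_diff_wedge k (b S); rewrite eS linear0 => /esym/eqP;
  rewrite subr_eq0 => /eqP ->.
by rewrite memvZ // OS_ideal_mull // ext_diff_OS // dependent_gt3 // S4.
Qed.

(** Write y as the derivation of e_k y plus e_k times the derivation of y; here e_k y has degree 4,
    hence lies in I. *)
Lemma OS_ideal_deg3 y : y \in ext_on K setT 3 -> (y \in I) = (ext_diff y \in I).
Proof.
move=> y3; apply/idP/idP => [|y0]; first exact: ext_diff_OS_ideal.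
have [->|yn0] := eqVneq y 0; first exact: mem0v.
(* A nonzero y of degree 3 supplies the generator e_k. *)
have [k _] : exists k : 'I_n, true.
  suff : exists S, y S != 0.
    case=> S; have /ext_coordP h := y3; move=> /h /andP[_ /eqP S3].
    by have /card_gt0P[k] : (0 < #|S|)%N by [rewrite S3]; exists k.
  apply/existsP; apply: contraNT yn0 => /existsPn h; apply/eqP/ffunP => S.
  by rewrite ffunE; apply/eqP/negPn/h.
have -> : y = ext_diff (ext_gen K k * y) + ext_gen K k * ext_diff y.
  by rewrite ext_diff_wedge subrK.
rewrite rpredD ?OS_ideal_mull //; apply/ext_diff_OS_ideal/OS_ideal_deg4.
by rewrite wedge_on ?inE.
Qed.

End OrlikSolomonIdeal.

(** * Euler characteristic *)

(** The binomial part of the Euler characteristic, with N = n - 1. Over [rat], [up] and [down] make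
    every binomial involving q and N together a rational multiple of 'C(N + q, q). *)
Lemma bin_euler_identity (N q : nat) :
  ('C(N + q.+3, q.+3) + 'C(N + q.+1, q.+1) * 'C(N.+1, 2) =
   'C(N + q.+2, q.+2) * N.+1 + 'C(N + q, q) * 'C(N, 2) + 'C(q.+2, 2) * 'C(N + q, q.+3))%N.
Proof.
have up m : ('C(N + m.+1, m.+1)%:R = (N%:R + m%:R + 1) / (m%:R + 1) * 'C(N + m, m)%:R :> rat)%R.
  apply: (@mulfI _ m.+1%:R); first by rewrite Num.Theory.pnatr_eq0.
  rewrite -natrM -mul_bin_diag addnS /= natrM -natr1 natrD -(natr1 m).
  have /negPf m0 : (m%:R + 1 != 0 :> rat) by rewrite natr1 Num.Theory.pnatr_eq0.
  by field; rewrite m0.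
have down m : ('C(N + q, q + m.+1)%:R = (N%:R - m%:R) / (q%:R + m%:R + 1) * 'C(N + q, q + m)%:R :> rat)%R.
  apply: (@mulfI _ (q + m).+1%:R); first by rewrite Num.Theory.pnatr_eq0.
  rewrite addnS -natrM mul_bin_left natrM -natr1 natrD.
  have m0 : (q%:R + m%:R + 1 != 0 :> rat) by rewrite -natrD natr1 Num.Theory.pnatr_eq0.
  (* If N < m, then N - m is negative in [rat] but truncated in [nat]; the binomial it multiplies is
     0. *)
  have [lt_Nm|le_mN] := ltnP N m.
    by rewrite (bin_small (m := (q + m)%N)) ?mulr0 // addnC ltn_add2l.
  rewrite addnC subnDl natrB //; field; exact: m0.
have bin2R m : ('C(m.+1, 2)%:R = (m%:R + 1) * m%:R / 2%:R :> rat)%R.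
  apply: (@mulfI _ 2%:R) => //; rewrite -natrM -mul_bin_diag bin1 natrM -natr1 /=.
  by field.
have binN : ('C(N, 2)%:R = N%:R * (N%:R - 1) / 2%:R :> rat)%R.
  case: (N) => [|m]; first by rewrite bin_small // !mul0r.
  by rewrite bin2R -natr1; field.
apply/eqP; rewrite -(Num.Theory.eqr_nat rat) !natrD !natrM; apply/eqP.
have d0 := down 0%N; have d1 := down 1%N; have d2 := down 2%N.
rewrite !addnS !addn0 in d0 d1 d2.
rewrite d2 d1 d0 !up !bin2R binN -!(natr1 q.+1) -!(natr1 q) -!(natr1 N).
have q1 : (q%:R + 1 != 0 :> rat) by rewrite natr1 Num.Theory.pnatr_eq0.
have q2 : (q%:R + 1 + 1 != 0 :> rat) by rewrite !natr1 Num.Theory.pnatr_eq0.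
have q3 : (q%:R + 2%:R + 1 != 0 :> rat) by rewrite -natrD natr1 Num.Theory.pnatr_eq0.
by field; apply/and3P.
Qed.

(** * Koszul homology of the Orlik-Solomon algebra *)

Section OrlikSolomonHomology.
Variables (F : fieldType) (n : nat) (A : arrangement F 3 n) (K : fieldType).
Hypothesis charK : [pchar K] =i pred0.
Local Notation E := (exterior K n).
Local Notation I := (OS_ideal A K).
Local Notation H := (@pencil F n A).
Local Notation form q := {ffun mon n q -> E}.
Local Notation XE j q := (@homog_form K n j q 0).
Local Notation kd := (linfun (@kos K n _)).

Lemma homog_formE p q : XE (p + q) q = pointwise (fun=> ext_on K setT p).
Proof.
apply/vspaceP => f; apply/form_coordP/pointwiseP => h t.
  by apply/ext_coordP => S /h; rewrite addn0 eqn_add2r subsetT.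
by move=> S; have /ext_coordP h1 := h t; move=> /h1; rewrite addn0 eqn_add2r subsetT.
Qed.

Lemma dim_pointwise_const q (U : {vspace E}) :
  \dim (pointwise (fun _ : mon n q => U)) = ('C(n + q - 1, q) * \dim U)%N.
Proof. by rewrite dim_pointwise sum_nat_const card_mon. Qed.

Lemma dim_homog_form p q : \dim (XE (p + q) q) = ('C(n + q - 1, q) * 'C(n, p))%N.
Proof. by rewrite homog_formE dim_pointwise_const dim_ext_on cardsT card_ord. Qed.

Lemma ideal_formsE p q :
  ideal_forms I (p + q) q = pointwise (fun=> (ext_on K setT p :&: I)%VS).
Proof.
apply/vspaceP => f; rewrite memv_cap homog_formE; apply/andP/pointwiseP.
  by move=> [/pointwiseP h /pointwiseP h'] t; rewrite memv_cap h h'.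
by move=> h; split; apply/pointwiseP => t; have := h t; rewrite memv_cap => /andP[].
Qed.

Lemma dim_ideal_forms p q :
  \dim (ideal_forms I (p + q) q) = ('C(n + q - 1, q) * \dim (ext_on K setT p :&: I))%N.
Proof. by rewrite ideal_formsE dim_pointwise_const. Qed.

Lemma OS_ideal_deg1 : (ext_on K setT 1%N :&: I = 0)%VS.
Proof.
apply/eqP; rewrite -subv0; apply/subvP => x;
  rewrite memv_cap memv0 => /andP[/ext_coordP x1 xI].
apply/eqP/ffunP => S; rewrite [RHS]ffunE; have [//|/x1 /andP[_ /eqP S1]] := eqVneq (x S) 0.
by rewrite (OS_ideal_low xI) // S1.
Qed.

Lemma OS_ideal_deg2 : (ext_on K setT 2%N :&: I = local_relations K H)%VS.
Proof.
apply/vspaceP => x; rewrite memv_cap; case x2: (x \in ext_on K setT 2) => /=.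
  exact: OS_ideal_local_relations.
by apply/esym/negP => /local_relationsP[]; rewrite x2.
Qed.

Lemma dim_pencil_relations :
  \dim (local_relations K H) = (\sum_x 'C(#|H x|.-1, 2))%N.
Proof.
exact: (dim_local_relations charK (@pencil_exists _ _ A) (@pencil_unique _ _ A)
          (@pencil_gt0 _ _ A)).
Qed.

Lemma ideal_forms_deg1 q : ideal_forms I q.+1 q = 0%VS.
Proof.
rewrite -(add1n q) ideal_formsE OS_ideal_deg1; apply/eqP; rewrite -subv0;
  apply/subvP => f /pointwiseP h.
by rewrite memv0; apply/eqP/ffunP => t; have := h t; rewrite memv0 ffunE => /eqP.
Qed.

(** Since I_1 = 0, the only cycles that [kos] kills in E are the boundaries, so [kos] carries the
    homology isomorphically onto the exact I_2-valued forms. *)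
Lemma strand_homology q :
  ideal_homology I q.+2 q = \dim (ideal_forms I q.+2 q :&: kd @: XE q.+2 q.+1).
Proof.
rewrite /ideal_homology ideal_forms_deg1 add0v.
have := limg_ker_dim (linfun (@kos K n q)) (XE q.+2 q.+1 :&: kd @^-1: ideal_forms I q.+2 q).
have -> : (XE q.+2 q.+1 :&: kd @^-1: ideal_forms I q.+2 q :&: lker (linfun (@kos K n q)) = kd @: XE q.+2 q.+2)%VS.
  apply/vspaceP => f; apply/idP/memv_imgP => [|[g gX ->]].
    rewrite !memv_cap memv_ker lfunE /= => /andP[/andP[fX _] /eqP f0].
    by have [g gX ->] := kos_homog_exact charK fX f0; exists g; rewrite ?lfunE.
  rewrite !memv_cap -memv_preim memv_ker !lfunE /= kos_kos // mem0v eqxx.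
  by rewrite kos_homog.
have -> : (kd @: (XE q.+2 q.+1 :&: kd @^-1: ideal_forms I q.+2 q) =
   ideal_forms I q.+2 q :&: kd @: XE q.+2 q.+1)%VS.
  apply/vspaceP => f; apply/memv_imgP/idP => [[g + ->]|].
    by rewrite !memv_cap -memv_preim memv_cap => /andP[gX ->]; rewrite memv_img.
  rewrite memv_cap => /andP[+ /memv_imgP[g gX e]] => fI.
  by exists g => //; rewrite memv_cap gX -memv_preim -e.
by move=> <-; rewrite addKn.
Qed.

Lemma strand_homology0 : ideal_homology I 2 0 = (\sum_x 'C(#|H x|.-1, 2))%N.
Proof.
rewrite -dim_pencil_relations strand_homology.
transitivity (\dim (ideal_forms I (2 + 0) 0));
  last by rewrite dim_ideal_forms bin0 mul1n OS_ideal_deg2.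
congr (\dim _); apply/capv_idPl/subvP => f; rewrite memv_cap => /andP[fX _].
have [||g gX ->] := @kos_exact0 K n charK _ (fun _ S => #|S| + 1 + 0 == 2)%N f _ fX.
- by move=> t k S; exact: homog_step.
- move=> t; apply/eqP; apply: contraT => h; have /form_coordP/(_ t set0 h) := fX.
  by rewrite cards0.
exact: memv_linfun_img.
Qed.

Lemma strand_homologyS q : ideal_homology I q.+3 q.+1 = \dim (linear_syzygies K H q).
Proof.
rewrite strand_homology; congr (\dim _); apply/vspaceP => f.
rewrite [in LHS]memv_cap [in RHS]memv_cap -(add2n q.+1) ideal_formsE OS_ideal_deg2.
case fI: (f \in pointwise _) => //=; apply/memv_imgP/idP => [[g gX ->]|].
  by rewrite memv_ker !lfunE /= kos_kos.
rewrite memv_ker lfunE /= => /eqP f0.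
have fX : f \in XE (2 + q.+1) q.+1.
  rewrite homog_formE; apply/pointwiseP => t; move/pointwiseP/(_ t): fI.
  by case/local_relationsP.
by have [g gX ->] := kos_homog_exact charK fX f0; exists g; rewrite ?lfunE.
Qed.

(** The derivation maps I_3 onto I_2, whose elements are closed, and its kernel on I_3 is all closed
    elements of degree 3. *)
Lemma dim_OS_ideal_deg3 : (0 < n)%N ->
  \dim (ext_on K setT 3%N :&: I) = ('C(n.-1, 3) + \sum_x 'C(#|H x|.-1, 2))%N.
Proof.
move=> n0; pose k : 'I_n := Ordinal n0; rewrite -dim_pencil_relations.
have T0 : (0 < #|[set: 'I_n]|)%N by rewrite cardsT card_ord.
have := dim_closed_on charK 3%N T0; rewrite cardsT card_ord => <-.
rewrite -(limg_ker_dim (linfun (@ext_diff K n))); congr (_ + _)%N; congr (\dim _).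
  apply/vspaceP => x; rewrite !memv_cap memv_ker lfunE /=.
  case x3: (x \in ext_on K setT 3) => //=; case: eqP => [x0|]; rewrite ?andbF ?andbT //.
  by rewrite (OS_ideal_deg3 A charK x3) x0 mem0v.
apply/vspaceP => y; apply/memv_imgP/idP => [[x + ->]|yl].
  rewrite memv_cap lfunE /= => /andP[x3]; rewrite (OS_ideal_deg3 A charK x3).
  by rewrite (OS_ideal_local_relations A charK) // ext_diff_on.
have /local_relationsP[y2 y0] := yl.
have dy : ext_diff y = 0.
  rewrite (sum_restrict (@pencil_exists _ _ A) (@pencil_unique _ _ A) y2) linear_sum big1 //.
  by move=> x _; exact: y0.
have kT : k \in setT by [].
have ey := ext_diff_exact kT y2 dy.
exists (ext_gen K k * y); last by rewrite lfunE.
rewrite memv_cap wedge_on //= (OS_ideal_deg3 A charK) ?wedge_on // -ey.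
by rewrite (OS_ideal_local_relations A charK).
Qed.

(** Given g, choose a closed h with [tder h = fdiff g]. Then [fdiff (kos h) = tder h = fdiff g], so
    g - kos h is killed by the derivation and lies in I. *)
Lemma kos_surj_deg3 q : (0 < n)%N ->
  (kd @: XE q.+3 q.+1 + ideal_forms I q.+3 q = XE q.+3 q)%VS.
Proof.
move=> n0; have T0 : (0 < #|[set: 'I_n]|)%N by rewrite cardsT card_ord.
apply/eqP; rewrite eqEsubv subv_add capvSl andbT; apply/andP; split.
  by apply/subvP => f /memv_imgP[g gX ->]; rewrite lfunE kos_homog.
apply/subvP => g gX; have gX3 t : g t \in ext_on K setT 3.
  by move: gX; rewrite -(add3n q) homog_formE => /pointwiseP.
have dg : fdiff g \in closed_on K setT 2 q.
  apply/closed_onP; split; last by apply/ffunP => t; rewrite !ffunE ext_diffK.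
  apply/form_coordP => t S; rewrite ffunE mon_inT /=.
  by have /ext_coordP := ext_diff_on (gX3 t); apply.
have [h hX e] := tder_surj charK T0 dg; have /closed_onP[hX2 h0] := hX.
have hXE : h \in XE q.+3 q.+1.
  apply/form_coordP => t S; have /form_coordP h2 := hX2; move=> /h2 /and3P[_ _ /eqP ->].
  by rewrite addn0.
rewrite -[g](subrK (kos h)) addrC memv_add //; first exact: memv_linfun_img.
rewrite memv_cap rpredB ?kos_homog //=; apply/pointwiseP => t.
have khX : kos h t \in ext_on K setT 3.
  have := kos_homog hXE; rewrite -(add3n q) homog_formE => /pointwiseP; exact.
have y3 : (g - kos h) t \in ext_on K setT 3 by rewrite ffunE [X in _ + X]ffunE rpredB.
rewrite (OS_ideal_deg3 A charK y3) ffunE [X in _ + X]ffunE linearB /=.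
have -> : ext_diff (kos h t) = ext_diff (g t).
  have /ffunP/(_ t) := fdiff_kos h; rewrite h0 linear0 subr0 -e.
  by rewrite [LHS]ffunE [RHS]ffunE.
by rewrite subrr mem0v.
Qed.

Lemma dim_kos_deg0 q : \dim (kd @: XE q.+1 q.+1) = \dim (XE q.+1 q.+1).
Proof.
apply: limg_dim_eq; apply/eqP; rewrite -subv0; apply/subvP => f;
  rewrite memv_cap memv_ker lfunE memv0 /=.
case/andP => fX /eqP f0; apply/eqP; apply: (kos_inj charK) f0.
apply/form_coordP => t S /(form_coordP _ _ fX); rewrite addn0 -{2}(add0n q.+1).
by rewrite eqn_add2r.
Qed.

(** Euler characteristic of A_0 (x) D_(q+3) -> A_1 (x) D_(q+2) -> A_2 (x) D_(q+1) -> A_3 (x) D_q,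
    with negative terms moved across. The first map is injective and the last surjective, so only
    the two middle homologies remain. *)
Lemma homology_euler q : (0 < n)%N ->
  (ideal_homology I q.+3 q + 'C(n + q.+1, q.+2) * n + 'C(n + q - 1, q) * 'C(n, 3)
     + 'C(n + q, q.+1) * (\sum_x 'C(#|H x|.-1, 2)) =
   ideal_homology I q.+3 q.+1 + 'C(n + q.+2, q.+3) + 'C(n + q, q.+1) * 'C(n, 2)
     + 'C(n + q - 1, q) * ('C(n.-1, 3) + \sum_x 'C(#|H x|.-1, 2)))%N.
Proof.
move=> n0; rewrite -dim_OS_ideal_deg3 // -dim_pencil_relations -OS_ideal_deg2.
have X0 := dim_homog_form 0 q.+3; have X1 := dim_homog_form 1 q.+2.
have X2 := dim_homog_form 2 q.+1; have X3 := dim_homog_form 3 q.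
have Z2 := dim_ideal_forms 2 q.+1; have Z3 := dim_ideal_forms 3 q.
rewrite ?add0n ?add1n ?add2n ?add3n ?addnS ?subn1 /= ?bin0 ?bin1 ?muln1 in X0 X1 X2 X3 Z2 Z3 *.
rewrite -X0 -X1 -X2 -X3 -Z2 -Z3.
have e1 := dim_preim_cap (linfun (@kos K n q)) (XE q.+3 q.+1) (ideal_forms I q.+3 q).
rewrite kos_surj_deg3 // in e1.
have e2 := dim_preim_cap (linfun (@kos K n q.+1)) (XE q.+3 q.+2) (ideal_forms I q.+3 q.+1).
rewrite [(kd @: _ + _)%VS]addvC in e2.
rewrite /ideal_homology ideal_forms_deg1 add0v dim_kos_deg0.
(* The inclusions [l1] and [l2] keep the subtractions in [ideal_homology] from being truncated. *)
have l1 : (ideal_forms I q.+3 q.+1 + kd @: XE q.+3 q.+2 <= XE q.+3 q.+1 :&: kd @^-1: ideal_forms I q.+3 q)%VS.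
  rewrite subv_add; apply/andP; split; apply/subvP => f.
    move=> fI; rewrite memv_cap -memv_preim lfunE kos_ideal_forms ?andbT //;
      last exact: OS_ideal_mull.
    by move: fI; rewrite memv_cap => /andP[].
  case/memv_imgP => g gX ->; rewrite memv_cap lfunE kos_homog //.
  by rewrite -memv_preim !lfunE /= kos_kos // mem0v.
have l2 : (kd @: XE q.+3 q.+3 <= XE q.+3 q.+2 :&: kd @^-1: ideal_forms I q.+3 q.+1)%VS.
  apply/subvP => f /memv_imgP[g gX ->]; rewrite memv_cap lfunE kos_homog //.
  by rewrite -memv_preim !lfunE /= kos_kos // mem0v.
have := dimvS l1; have := dimvS l2; rewrite dim_kos_deg0; move: e1 e2.
move: (\dim (XE q.+3 q)) (\dim (XE q.+3 q.+1)) (\dim (XE q.+3 q.+2)) (\dim (XE q.+3 q.+3)).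
move: (\dim (ideal_forms I q.+3 q)) (\dim (ideal_forms I q.+3 q.+1)).
move: (\dim (XE q.+3 q.+1 :&: _)) (\dim (XE q.+3 q.+2 :&: _)) (\dim (_ + _)).
lia.
Qed.

End OrlikSolomonHomology.

(** * The graded Betti numbers *)

Section MinimalLinearStrand.
Variables (F : fieldType) (n : nat) (A : arrangement F 3 n) (K : fieldType).
Hypothesis charK : [pchar K] =i pred0.
Local Notation I := (OS_ideal A K).
Variable P : free_resolution I.
Local Notation H := (@pencil F n A).

Lemma tor_dim_OS q j : tor_dim P q.+1 j = ideal_homology I j q.
Proof.
by apply: tor_dim_ideal_homology => // [x y|d y];
  [exact: OS_ideal_mull | exact: OS_ideal_comp].
Qed.

Lemma MLS_linear_strand q : MLS A P ->
  tor_dim P q.+2 q.+3 = (q.+2 * \sum_x 'C(#|H x|.-1 + q.+1, q.+3))%N.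
Proof.
have dimS q' := dim_sum_local_syzygies charK (@pencil_unique _ _ A) (@pencil_gt0 _ _ A) q'.
have sub q' := @sum_local_syzygies_sub K n _ _ (@pencil_unique _ _ A) q'.
rewrite /MLS (sum_pencil A (fun m => 'C(m.+1, 3))) !tor_dim_OS !strand_homologyS // => mls.
suff : (linear_syzygies K H q <= sum_local_syzygies K H q)%VS.
  move=> le; rewrite big_distrr /= -dimS; apply/eqP.
  by rewrite eqn_leq !dimvS.
elim: q => [|q IHq]; last first.
  by apply: linear_syzygies_prolong IHq; [exact: pencil_exists | exact: pencil_unique].
(* Base case: MLS is an equality of dimensions, so the sum of the local strands fills the first
   space of linear syzygies. *)
suff -> : linear_syzygies K H 0 = sum_local_syzygies K H 0 by [].
apply/esym/eqP; rewrite eqEdim sub dimS mls big_distrr /=.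
by apply/eq_leq/eq_bigr => x _; rewrite addn1.
Qed.

Lemma tor_dim_quadratic : tor_dim P 1 2 = (\sum_x 'C(#|H x|.-1, 2))%N.
Proof. by rewrite tor_dim_OS strand_homology0. Qed.

Lemma tor_dim_euler q :
  (tor_dim P q.+1 q.+3)%:Z = (tor_dim P q.+2 q.+3)%:Z
    + ('C(q.+2, 2) * 'C(n + q.+1 - 2, q.+3))%N%:Z
    - ('C(n + q.+1 - 2, q.+1) * \sum_x 'C(#|H x|.-1, 2))%N%:Z.
Proof.
rewrite !tor_dim_OS; have [n0|n0] := posnP n.
  have X2 := dim_homog_form n K 2 q.+1; have X1 := dim_homog_form n K 1 q.+2.
  have -> : ideal_homology I q.+3 q = 0%N.
    apply/eqP; rewrite -leqn0; apply: leq_trans (leq_subr _ _) _.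
    by apply: leq_trans (dimvS (capvSl _ _)) _; rewrite -(add2n q.+1) X2 n0 muln0.
  have -> : ideal_homology I q.+3 q.+1 = 0%N.
    apply/eqP; rewrite -leqn0; apply: leq_trans (leq_subr _ _) _.
    by apply: leq_trans (dimvS (capvSl _ _)) _; rewrite -(add1n q.+2) X1 n0 muln0.
  have b1 : 'C(q.+1 - 2, q.+1) = 0%N by apply: bin_small; lia.
  have b3 : 'C(q.+1 - 2, q.+3) = 0%N by apply: bin_small; lia.
  by move: (\sum_x _)%N => s; rewrite n0 add0n b1 b3 muln0.
have := homology_euler A charK q n0; have := bin_euler_identity n.-1 q.
move: (\sum_x _)%N (ideal_homology _ _ q) (ideal_homology _ _ q.+1) => s t1 t2.
have [N ->] : exists N, n = N.+1 by exists n.-1; rewrite prednK.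
rewrite /= (_ : (N.+1 + q.+1 - 2 = N + q)%N); last by lia.
rewrite !addSn !addnS !subn1 /= [in 'C(N.+1, 3)]binS.
have := binS (N + q) q.
move: 'C(q.+2, 2) => c.
rewrite -!addnS.
nia.
Qed.

End MinimalLinearStrand.

Theorem theorem2p11 (R : realType) (K : fieldType) (charK : [pchar K] =i pred0)
    (n : nat) (A : arrangement R[i] 3 n) (P : free_resolution (OS_ideal A K))
    (hMLS : MLS A P) (i : nat) (hi : (1 <= i)%N) :
  tor_dim P i i.+1 = (i * \sum_(X <- L2 A) 'C(mu A X + i - 1, i.+1))%N /\
  (tor_dim P i i.+2)%:Z =
    (tor_dim P i.+1 i.+2)%:Z
    + ('C(i.+1, 2) * 'C(n + i - 2, i.+2))%N%:Z
    - ('C(n + i - 2, i) * \sum_(X <- L2 A) 'C(mu A X, 2))%N%:Z.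
Proof.
case: i hi => // q _; split; last first.
  by rewrite (sum_pencil A (fun m => 'C(m, 2))); apply: tor_dim_euler.
rewrite (sum_pencil A (fun m => 'C(m + q.+1 - 1, q.+2))).
(* For i = 1 the Betti number counts the quadratic relations; from i = 2 on the local strands are
   counted. *)
case: q => [|q]; last first.
  rewrite (MLS_linear_strand charK q hMLS); congr (_ * _)%N.
  by apply: eq_bigr => x _; rewrite [in RHS]addnS subn1.
by rewrite tor_dim_quadratic // mul1n; apply: eq_bigr => x _; rewrite addnK.
Qed.
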